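(* Let $q$ be a prime power, let $m$ be a positive integer relatively prime to $q$, and let $k$ be an integer with $1<k<\sigma_0(m)$, where $\sigma_0(m)$ denotes the number of positive divisors of $m$. Let $\mathbf d=(d_1,\ldots,d_k)\in\lambda_k(m)$ and let $\mathbf a=(a_1,\ldots,a_k)\in\mathbb F_{\mathbf d}$ be a normal $\mathbf d$-admissible $k$-tuple. Suppose that $\gcd(d_i,d_j)=1$ for all $1\le i<j\le k$. Then there exists an element $\alpha\in\mathbb F_{q^m}$ that is primitive and normal over $\mathbb F_q$ and satisfies $\operatorname{Tr}_{m/d_i}(\alpha)=a_i$ for every $1\le i\le k$, provided that one of the following holds: (i) (a) $k=4$ and $q\ge 1334$; or (b) $k=5$ and $q\ge 9$; or (c) $k=6$ and $q\ge 7$; or (d) $k=7$ and $q\ge 5$. (ii) $k=3$, $m\ge 60$ and $q\ge 2.2660\cdot 10^{24072855}$. (iii) $k=2$ and: (a) $d_1\ge 8$ and $q$ is large enough; or (b) $d_1=7$, $(d_1,d_2)\ne(7,8)$ and $q$ is large enough; or (c) $d_1=6$, $d_2\ge 13$ and $q$ is large enough. In (iii), ''$q$ is large enough'' means that for each pair $(d_1,d_2)$ of the indicated type there is a constant $Q'$, depending only on $d_1$ and $d_2$, such that the conclusion holds whenever $q\ge Q'$.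
   Context: For a prime power $q$, $\mathbb F_q$ is the finite field with $q$ elements, and all fields $\mathbb F_{q^d}$ with $d\mid m$ are regarded as subfields of $\mathbb F_{q^m}$. For $d\mid n$ and $\alpha\in\mathbb F_{q^n}$, $\operatorname{Tr}_{n/d}(\alpha)=\sum_{i=0}^{n/d-1}\alpha^{q^{id}}\in\mathbb F_{q^d}$. An element of $\mathbb F_{q^m}$ is primitive if it generates the cyclic group $\mathbb F_{q^m}^*$. An element $\alpha\in\mathbb F_{q^n}$ is normal over $\mathbb F_q$ (as an element of $\mathbb F_{q^n}$) if $\{\alpha,\alpha^q,\ldots,\alpha^{q^{n-1}}\}$ is a basis of $\mathbb F_{q^n}$ over $\mathbb F_q$. $\lambda_k(m)$ is the set of $k$-tuples $\mathbf d=(d_1,\ldots,d_k)$ where $d_1<\cdots<d_k<m$ are positive divisors of $m$ such that $d_i\nmid d_j$ for all $1\le i<j\le k$. For such $\mathbf d$, $\mathbb F_{\mathbf d}=\prod_{i=1}^k\mathbb F_{q^{d_i}}$. A $k$-tuple $\mathbf a=(a_1,\ldots,a_k)\in\mathbb F_{\mathbf d}$ is $\mathbf d$-admissible if for all $1\le i<j\le k$, $\operatorname{Tr}_{d_i/\gcd(d_i,d_j)}(a_i)=\operatorname{Tr}_{d_j/\gcd(d_i,d_j)}(a_j)$. A $\mathbf d$-admissible $\mathbf a$ is normal if, for every $i$, $a_i$ is normal over $\mathbb F_q$ as an element of $\mathbb F_{q^{d_i}}$. *)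

(* Defs.v *)
From HB Require Import structures.
From mathcomp Require Import all_boot all_order all_algebra all_fingroup.
From mathcomp Require Import all_solvable all_field.

Set Implicit Arguments.
Unset Strict Implicit.
Unset Printing Implicit Defensive.

Import GRing.Theory.
Local Open Scope ring_scope.

(* In an extension L of a finite field F, q is #|F| and m is \dim {:L}, so     *)
(* that L is F_(q^m); the subfield F_(q^d) is the K : {subfield L} such that   *)
(* \dim K = d (it exists iff d %| m, and is then unique).                      *)

Definition Tr (F : finFieldType) (L : fieldExtType F) (n d : nat) (x : L) : L :=
  \sum_(i < (n %/ d)%N) x ^+ (#|F| ^ (i * d))%N.

(* finvect_type L is L itself, equipped with its finite field structure.       *)
Definition is_primitive (F : finFieldType) (L : fieldExtType F) (x : L) : Prop :=
  exists2 u : {unit (finvect_type L)},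
    generator [set: {unit (finvect_type L)}] u & FinRing.uval u = x.

Definition is_normal (F : finFieldType) (L : fieldExtType F)
    (K : {vspace L}) (x : L) : bool :=
  basis_of K [seq x ^+ (#|F| ^ i)%N | i <- iota 0 (\dim K)].

Definition lambda (m k : nat) (d : k.-tuple nat) : Prop :=
  (forall i : 'I_k, [&& 0 < tnth d i, tnth d i < m & tnth d i %| m])%N /\
  (forall i j : 'I_k, (i < j)%N ->
     ((tnth d i < tnth d j) && ~~ (tnth d i %| tnth d j))%N).

Definition admissible (F : finFieldType) (L : fieldExtType F) (k : nat)
    (d : k.-tuple nat) (a : k.-tuple L) : Prop :=
  forall i j : 'I_k, (i < j)%N ->
    let g := gcdn (tnth d i) (tnth d j) in
    Tr (tnth d i) g (tnth a i) = Tr (tnth d j) g (tnth a j).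

Definition pairwise_coprime (k : nat) (d : k.-tuple nat) : Prop :=
  forall i j : 'I_k, (i < j)%N -> coprime (tnth d i) (tnth d j).

(* 2.2660 * 10^24072855 = 2266 * 10^24072852; the split, locked exponent only  *)
(* prevents the evaluation of huge unary numerals.                             *)
Definition q_bound3 : nat :=
  (2266 * 10 ^ locked ((24 * 1000 + 72) * 1000 + 852))%N.

Definition traces_prescribable (F : finFieldType) (L : fieldExtType F)
    (k : nat) (d : k.-tuple nat) : Prop :=
  forall (K : 'I_k -> {subfield L}) (a : k.-tuple L),
    (forall i, \dim (K i) = tnth d i) ->
    (forall i, tnth a i \in K i) ->
    admissible d a ->
    (forall i, is_normal (K i) (tnth a i)) ->
    exists alpha : L,
      [/\ is_primitive alpha, is_normal {:L} alpha &
          forall i, Tr (\dim {:L}) (tnth d i) alpha = tnth a i].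

(* Main.v *)
Require Import Defs.
From HB Require Import structures.
From mathcomp Require Import all_boot all_order all_algebra all_fingroup.
From mathcomp Require Import all_solvable all_field.
From mathcomp Require Import zify ring.

Set Implicit Arguments.
Unset Strict Implicit.
Unset Printing Implicit Defensive.

Import Order.TTheory GRing.Theory Num.Theory.

(** Let [q = #|F|], [m = \dim L], [Q = q ^ m], [n = Q - 1] and let [s] be the
    sum of the degrees [d_i].

    The conditions separate.  As a module over [F[X]], with [X] acting as
    [x |-> x ^ q], the field [L] is killed by [X^m - 1], which is separable
    because [m] is prime to [q].  The trace onto the subfield of degree [d_i] is
    the action of [(X^m - 1) / (X^d_i - 1)]; hence the elements with the
    prescribed traces form an affine subspace [x0 + V0] of codimension at most
    [s], where [x0] is an explicit combination of the [a_i]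
    ([exists_traces]).  An element is normal iff it avoids the subspace [W_P]
    killed by [(X^m - 1) / P] for every monic irreducible factor [P]; if [P]
    divides some [X^d_i - 1] this is inherited from the normality of [a_i], and
    the remaining [r] factors have to be avoided by hand.  An element is
    primitive iff it avoids the subgroup of [l]-th powers for every prime [l]
    dividing [n].

    So one has to find a point of [T = (x0 + V0) minus the W_P] outside these
    subgroups.  The input that makes this possible is that additive and
    multiplicative structures are nearly independent: for a coset [A] of an
    additive subgroup and a multiplicative subgroup [H],
    [(Q |A & H| - |A| |H|)^2 <= Q^3] ([sqr_discr_subspace]).  This replaces the
    usual estimate of Gauss sums and has an elementary proof: the variance of
    the number of elements of [H] in the dilated translates [b (t + V)] can be
    computed exactly, and that number does not change when [b] is multiplied by
    an element of [H].  Affine subspaces, like subgroups, are stable under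
    intersection, so removing one more of them from [A] or [H] at most
    quadruples the bound on the squared discrepancy ([sqr_discr_remove]).  If
    [w] is the number of primes dividing [n], a suitable element exists as soon
    as [4^(w + r) Q^3 < (totient n * |T|)^2] ([non_powers_meet_affine]).

    It remains to estimate three quantities.  Translation along the [P]-primary
    component shows that avoiding [W_P] keeps a proportion at least [1 - 1/q] of
    the elements, so [|T| >= (1 - 1/q)^r q^(m - s)]
    ([card_remove_subspaces]).  Since [2 l <= (l - 1) l^(1/5)] for primes
    [l >= 37], the ratio [2^w n / totient n] is at most [2^22 n^(1/5)]
    ([totient_primes_bound]).  Finally [r <= m], and [2 r <= m + q] because at
    most [q] of the factors are linear ([factors_count]).  For [q >= 5]
    everything reduces to [2^(684 + 40 r) q^(30 s) < q^(9 m)]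
    ([counting_bound]).  The [d_i] being pairwise coprime, their product is at
    most [m], which makes [s / m] small enough in each of the cases. *)

(** * Discrepancy of a multiplicative and an additive subset *)

Lemma in_bigcup_seq (T : finType) (Bs : seq {set T}) x :
  (x \in \bigcup_(B <- Bs) B) = has (fun B : {set T} => x \in B) Bs.
Proof.
elim: Bs => [|B Bs IH]; first by rewrite big_nil inE.
by rewrite big_cons inE IH.
Qed.

Section Discrepancy.

Variable E : finFieldType.
Local Open Scope ring_scope.
Implicit Types (A B T V H : {set E}).

(** [#|E|] times the excess of [#|A :&: T|] over its expected value, scaled so
    as to stay in [int]. *)
Definition discr A T : int :=
  (#|E| * #|A :&: T|)%N%:Z - (#|A| * #|T|)%N%:Z.

Lemma discr_setDl A B T : discr (A :\: B) T = discr A T - discr (A :&: B) T.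
Proof.
rewrite /discr; have cA := cardsID B A; have cT := cardsID B (A :&: T).
have -> : (A :\: B) :&: T = (A :&: T) :\: B by rewrite setIDAC.
have -> : A :&: B :&: T = A :&: T :&: B by rewrite setIAC.
by rewrite -cA -cT; lia.
Qed.

Lemma discrC A T : discr A T = discr T A.
Proof. by rewrite /discr setIC [(#|A| * _)%N]mulnC. Qed.

(** The discrepancy is additive in its first argument, so removing [B] from [A]
    subtracts the discrepancy of [A :&: B], which satisfies the same bound when
    the family [S] is stable under intersection; then [(x - y)^2 <= 2 x^2 + 2 y^2]
    yields the factor 4. Working with squares keeps the bound [Q^(3/2)] on the
    discrepancies of subspaces within [int]. *)
Lemma sqr_discr_remove (S : {set E} -> Prop) (c : int) T (Bs : seq {set E}) :
    (forall A B, S A -> S B -> S (A :&: B)) ->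
    (forall A, S A -> discr A T ^+ 2 <= c) ->
    {in Bs, forall B, S B} ->
  forall A, S A ->
  discr (A :\: \bigcup_(B <- Bs) B) T ^+ 2 <= (4 ^ size Bs)%N%:Z * c.
Proof.
move=> SI Sc; elim: Bs => [|B Bs IH] SB A SA.
  by rewrite big_nil setD0 expn0 mul1r Sc.
have SB' : {in Bs, forall B, S B} by move=> C CB; apply: SB; rewrite inE CB orbT.
have SBB : S B by apply: SB; rewrite mem_head.
have h1 := IH SB' A SA; have h2 := IH SB' _ (SI _ _ SA SBB).
rewrite big_cons setUC -setDDl discr_setDl.
have -> : (A :\: \bigcup_(B <- Bs) B) :&: B
          = (A :&: B) :\: \bigcup_(B <- Bs) B by rewrite setIDAC.
move: h1 h2; set x := discr _ _; set y := discr _ _ => h1 h2.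
rewrite /= expnS PoszM -mulrA.
have : 0 <= (x + y) ^+ 2 by apply: sqr_ge0.
by move: h1 h2; set z := _ * c; clearbody x y z; lia.
Qed.

Section AdditiveMultiplicative.

Variables V H : {set E}.
Hypotheses (zmodV : zmod_closed V) (divH : divr_closed H) (H0 : 0 \notin H).

(** The number of elements of [H] in [b (t + V)]. *)
Let N (b t : E) : nat := (\sum_(x in H) (x / b - t \in V)%R)%N.

Lemma subset_closedB x y : x \in V -> (x - y \in V) = (y \in V).
Proof.
case: zmodV => V0 VB Vx; apply/idP/idP => [Vxy|Vy]; last exact: VB.
by rewrite -(subKr x y); apply: VB.
Qed.

Let count_translates u : (\sum_t (u - t \in V)%R = #|V|)%N.
Proof.
rewrite (reindex_inj (inv_inj (subKr u))) -sum1_card [RHS]big_mkcond /=.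
by apply: eq_bigr => t _; rewrite subKr; case: (_ \in _).
Qed.

Let count_common u u' :
  (\sum_t (u - t \in V)%R * (u' - t \in V)%R = (u - u' \in V)%R * #|V|)%N.
Proof.
rewrite -(count_translates u) big_distrr /=; apply: eq_bigr => t _.
case Ht: (u - t \in V); last by rewrite mul0n muln0.
by rewrite mul1n muln1 -(subset_closedB _ Ht) opprB addrA subrK.
Qed.

Let V_gt0 : (0 < #|V|)%N.
Proof. by apply/card_gt0P; exists 0; case: zmodV. Qed.

Let count_dilates x : x != 0 -> (\sum_(b | (b != 0)%R) (x / b \in V)%R = #|V|.-1)%N.
Proof.
move=> nz_x; rewrite (reindex_onto (fun b => x / b) (fun b => x / b)) /=.
  have [V0 _] := zmodV; rewrite (cardsD1 0) V0 /= -sum1_card.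
  rewrite big_mkcond [RHS]big_mkcond; apply: eq_bigr => b _.
  rewrite !inE mulf_eq0 invr_eq0 (negPf nz_x) /=.
  have [->|nz_b] /= := eqVneq b 0; first by [].
  have -> : x / (x / b) = b by field; rewrite nz_b nz_x.
  by rewrite eqxx; case: (b \in V).
by move=> b nz_b; field; rewrite nz_x nz_b.
Qed.

Let Q_gt0 : (0 < #|E|)%N. Proof. by apply/card_gt0P; exists 0. Qed.

Let sum_nz n : (\sum_(b : E | (b != 0)%R) n = #|E|.-1 * n)%N.
Proof.
by rewrite sum_nat_cond_const -(cardC1 (0 : E)) cardsE.
Qed.

(* First and second moments of [N] over all dilations and translations. In the
   second one, a pair [x != y] of elements of [H] is counted by those [b] for
   which [(x - y) / b] is one of the nonzero elements of [V]. *)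
Let moment1 : (\sum_(b | (b != 0)%R) \sum_t N b t = #|E|.-1 * (#|H| * #|V|))%N.
Proof.
rewrite -sum_nz; apply: eq_bigr => b _.
rewrite exchange_big /= -sum_nat_const; apply: eq_bigr => x _.
exact: count_translates.
Qed.

Let moment2 : (\sum_(b | (b != 0)%R) \sum_t N b t ^ 2 =
  #|V| * (#|H| * (#|E|.-1 + #|H|.-1 * #|V|.-1)))%N.
Proof.
transitivity (\sum_(x in H) \sum_(y in H) \sum_(b | (b != 0)%R)
                ((x - y) / b \in V)%R * #|V|)%N.
  transitivity (\sum_(b | (b != 0)%R) \sum_(x in H) \sum_(y in H)
                ((x - y) / b \in V)%R * #|V|)%N.
    apply: eq_bigr => b _.
    transitivity (\sum_t \sum_(x in H) \sum_(y in H)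
       (x / b - t \in V)%R * (y / b - t \in V)%R)%N.
      apply: eq_bigr => t _; rewrite -mulnn big_distrl /=.
      by apply: eq_bigr => x _; rewrite big_distrr.
    rewrite exchange_big /=; apply: eq_bigr => x _.
    rewrite exchange_big /=; apply: eq_bigr => y _.
    by rewrite count_common mulrBl.
  rewrite exchange_big /=; apply: eq_bigr => x _.
  by rewrite exchange_big /=.
rewrite mulnCA -sum_nat_const; apply: eq_bigr => x Hx.
rewrite (bigD1 x) //= subrr.
under eq_bigr => b _ do rewrite mul0r.
case: (zmodV) => -> _; rewrite sum_nz mul1n.
under eq_bigr => y /andP[_ nyx].
  rewrite -big_distrl /= count_dilates; last by rewrite subr_eq0 eq_sym.
over.
rewrite sum_nat_cond_const (cardsD1 x H) Hx /=.
have -> : [set y | (y \in H) && (y != x)] = H :\ x.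
  by apply/setP => y; rewrite !inE andbC.
by lia.
Qed.

(* Multiplication by [b \in H] permutes [H], so all the dilations by elements of
   [H] give the same count. *)
Let N_invariant b t c : b \in H -> t - c \in V -> N b t = N 1 c.
Proof.
move=> Hb Vtc; have [H1 HV] := divH.
have Hnz x : x \in H -> x != 0 by apply: contraTneq => ->.
have HM x y : x \in H -> y \in H -> x * y \in H.
  by move=> Hx Hy; rewrite -[y]invrK; apply: (HV _ _ Hx); rewrite -div1r HV.
rewrite /N (reindex_onto ( *%R b) (fun x => x / b)) /=; last first.
  by move=> x Hx; field; apply: Hnz.
apply: eq_big => [x|x Hx].
  have -> : (b * x) / b = x by rewrite mulrAC divff ?mul1r ?Hnz.
  rewrite eqxx andbT; apply/idP/idP=> [Hbx|]; last exact: HM.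
  have -> : x = (b * x) / b by rewrite mulrAC divff ?mul1r ?Hnz.
  exact: HV.
have -> : (b * x) / b = x by rewrite mulrAC divff ?mul1r ?Hnz.
have -> : x / 1 - c = (t - c) - (t - x) by rewrite divr1; ring.
by rewrite (subset_closedB _ Vtc) -(opprB x t) -sub0r (subset_closedB _ (proj1 zmodV)).
Qed.

(** The moments give the total variance of [N] in closed form. Among its
    nonnegative terms, the [#|H| * #|V|] ones with [b \in H] and [t \in c + V]
    are all equal to the squared discrepancy of [H] and [c + V]; hence one of
    them is at most the total divided by [#|H| * #|V|]. *)
Lemma sqr_discr_subspace c :
  discr H [set x | x - c \in V] ^+ 2 <= (#|E| ^ 3)%N%:Z.
Proof.
have cT : #|[set x | x - c \in V]| = #|V|.
  rewrite -(count_translates (- c)) (reindex_inj oppr_inj) /=.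
  rewrite -sum1_card big_mkcond /=; apply: eq_bigr => x _.
  by rewrite inE opprK addrC; case: (_ \in V).
have cN : #|H :&: [set x | x - c \in V]| = N 1 c.
  rewrite -sum1_card big_mkcond /N [RHS]big_mkcond /=.
  by apply: eq_bigr => x _; rewrite !inE divr1; case: (x \in H); case: (_ \in V).
rewrite /discr cT cN.
set Q := #|E|; set h := #|H|; set v := #|V|.
pose D b t : int := (Q * N b t)%N%:Z - (h * v)%N%:Z.
have total : \sum_(b | b != 0) \sum_t D b t ^+ 2
   = Q%:Z * (h * v)%N%:Z * (Q%:Z - h%:Z) * (Q%:Z - v%:Z).
  transitivity ((Q ^ 2)%N%:Z * (\sum_(b | (b != 0)%R) \sum_t N b t ^ 2)%N%:Z
      - 2 * Q%:Z * (h * v)%N%:Z * (\sum_(b | (b != 0)%R) \sum_t N b t)%N%:Z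
      + (h * v)%N%:Z ^+ 2 * (Q.-1 * Q)%N%:Z).
    have sumQ (z : int) : z * Q%:R = \sum_(t : E) z by rewrite sumr_const mulr_natr.
    rewrite -!natz !natr_sum !mulr_sumr -sum_nz natr_sum mulr_sumr -sumrB -big_split /=.
    apply: eq_bigr => b _; rewrite !natr_sum !mulr_sumr (sumQ (_ ^+ 2)).
    rewrite -sumrB -big_split /=; apply: eq_bigr => t _.
    by rewrite /D /= !natz; lia.
  rewrite moment1 moment2 -/Q -/h -/v.
  have h_gt0 : (0 < h)%N by apply/card_gt0P; exists 1; case: divH.
  have [Q' ->] : exists Q', Q = Q'.+1 by exists Q.-1; rewrite prednK.
  have [v' ->] : exists v', v = v'.+1 by exists v.-1; rewrite prednK.
  have [h' ->] : exists h', h = h'.+1 by exists h.-1; rewrite prednK.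
  rewrite /= !PoszM !intS; ring.
have part : (h * v)%N%:Z * D 1 c ^+ 2 <= \sum_(b | b != 0) \sum_t D b t ^+ 2.
  rewrite [leRHS](bigID (mem H)) /=.
  apply: ler_wpDr; first by apply: sumr_ge0 => b _; apply: sumr_ge0 => t _; apply: sqr_ge0.
  have -> : \sum_(b | (b != 0) && (b \in H)) \sum_t D b t ^+ 2
          = \sum_(b in H) \sum_t D b t ^+ 2.
    by apply: eq_bigl => b; case: eqP => [->|//]; rewrite (negPf H0).
  rewrite PoszM -mulrA -[h%:Z]natz mulr_natl -sumr_const.
  apply: ler_sum => b Hb; rewrite (bigID (fun t => t - c \in V)) /=.
  apply: ler_wpDr; first by apply: sumr_ge0 => t _; apply: sqr_ge0.
  rewrite (eq_bigr (fun=> D 1 c ^+ 2)); last by move=> t Vt; rewrite /D (N_invariant Hb Vt).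
  by rewrite sumr_const -natz mulr_natl -cardsE cT.
have hv : (0 < h * v)%N.
  by rewrite muln_gt0 V_gt0 andbT; apply/card_gt0P; exists 1; case: divH.
have hQ : (h <= Q)%N by apply: max_card.
have vQ : (v <= Q)%N by apply: max_card.
move: part; rewrite total -/(D 1 c); move: (D 1 c) => z part.
have {part} : z ^+ 2 <= Q%:Z * (Q%:Z - h%:Z) * (Q%:Z - v%:Z).
  by rewrite -(@ler_pM2l _ (h * v)%N%:Z) //; apply: (le_trans part); lia.
move=> /le_trans; apply.
rewrite !expnS expn0 muln1 !PoszM mulrA.
have hQ0 : 0 <= Q%:Z - h%:Z by rewrite subr_ge0 lez_nat.
have vQ0 : 0 <= Q%:Z - v%:Z by rewrite subr_ge0 lez_nat.
by rewrite !ler_pM ?mulr_ge0 // gerBl.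
Qed.

End AdditiveMultiplicative.
End Discrepancy.

(** * Primitive elements as non-powers *)

Section Primitive.

Variable E : finFieldType.
Local Open Scope ring_scope.

Let n := #|E|.-1.

(** An [l]-th power is a root of [X ^ (n / l) - 1]; writing the set of non-powers
    as a difference is what lets [sqr_discr_remove] apply. *)
Definition non_powers : {set E} :=
  [set x | x != 0] :\:
    \bigcup_(B <- [seq [set x : E | x ^+ (n %/ l) == 1] | l <- primes n]) B.

Let n_gt0 : (0 < n)%N.
Proof. by rewrite /n -subn1 subn_gt0 finNzRing_gt1. Qed.

Lemma in_non_powers x :
  (x \in non_powers) =
  (x != 0) && all (fun l => x ^+ (n %/ l) != 1) (primes n).
Proof.
rewrite !inE in_bigcup_seq andbC has_map -all_predC; congr (_ && _).
by apply: eq_all => l; rewrite /= inE.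
Qed.

(** If the order of [u] is a proper divisor of [n], then any prime [l] dividing
    its index witnesses that [u] is an [l]-th power. *)
Lemma generator_non_powers (u : {unit E}) :
  (FinRing.uval u \in non_powers) = generator [set: {unit E}] u.
Proof.
have cE : #|[set: {unit E}]| = n by apply: card_finField_unit.
have ou : (#[u]%g %| n)%N by rewrite -cE order_dvdG ?inE.
have uX k : (FinRing.uval u ^+ k == 1) = (#[u]%g %| k)%N.
  by rewrite order_dvdn -val_eqE /= FinRing.val_unitX.
have -> : generator [set: {unit E}] u = (#[u]%g == n).
  rewrite /generator eq_sym eqEcard subsetT cE -[#|<[u]>%g|]/(#[u]%g) /=.
  by rewrite eqn_leq (dvdn_leq n_gt0 ou).
rewrite in_non_powers -unitfE; case: u ou uX => x Ux /= ou uX; rewrite Ux /=.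
apply/allP/eqP => [np | ou_n l /[!mem_primes]/and3P[l_pr _ l_n]]; last first.
  rewrite uX ou_n; apply: contraTN (l_n) => n_nl.
  have := dvdn_leq _ n_nl; rewrite divn_gt0 ?prime_gt0 // dvdn_leq // => /(_ isT).
  by rewrite leqNgt ltn_Pdiv ?prime_gt1.
apply/eqP; apply: contraT => ou_n.
have idx_gt1 : (1 < n %/ #[FinRing.Unit Ux]%g)%N.
  rewrite ltn_divRL // mul1n ltn_neqAle ou_n /=; exact: dvdn_leq.
have l_idx := pdiv_dvd (n %/ #[FinRing.Unit Ux]%g).
set l := pdiv _ in l_idx; have l_pr : prime l by apply: pdiv_prime.
have l_n : (l %| n)%N by apply: dvdn_trans l_idx (dvdn_div _).
have /np : l \in primes n by rewrite mem_primes l_pr n_gt0 l_n.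
rewrite uX; case/negP; rewrite dvdn_divRL // mulnC.
by rewrite -(divnK ou) dvdn_pmul2r ?order_gt0.
Qed.

Lemma card_non_powers : #|non_powers| = totient n.
Proof.
have -> : non_powers = FinRing.uval @: [set u | generator [set: {unit E}] u].
  apply/setP=> x; apply/idP/imsetP => [x_np|[u gen_u ->]]; last first.
    by rewrite inE in gen_u; rewrite generator_non_powers.
  have nz_x : x != 0 by move: x_np; rewrite in_non_powers => /andP[].
  exists (finField_unit nz_x) => //.
  by rewrite inE -generator_non_powers.
rewrite card_imset; last exact: val_inj.
have [a defU] := cyclicP (field_unit_group_cyclic [set: {unit E}]%G).
rewrite /n -card_finField_unit [in RHS]defU -[#|<[a]>%g|]/(#[a]%g) totient_gen.
by apply: eq_card => u; rewrite !inE -defU.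
Qed.

Lemma divr_closed_roots (k : nat) : divr_closed [set x : E | x ^+ k == 1].
Proof.
split=> [|x y]; rewrite !inE ?expr1n // => /eqP xk /eqP yk.
by rewrite expr_div_n xk yk divr1.
Qed.

(** Subgroups of the multiplicative group are stable under intersection, so the
    sieve over the primes dividing [n] costs a factor 4 for each of them. *)
Lemma sqr_discr_non_powers (T : {set E}) (c : int) :
    (forall H : {set E}, divr_closed H -> 0 \notin H -> discr H T ^+ 2 <= c) ->
  discr non_powers T ^+ 2 <= (4 ^ size (primes n))%N%:Z * c.
Proof.
move=> Hc; rewrite -(size_map (fun l => [set x : E | x ^+ (n %/ l) == 1])).
apply: (@sqr_discr_remove _ (fun H => divr_closed H /\ 0 \notin H)).
- move=> A B [[A1 AV] A0] [[B1 BV] _]; split; last by rewrite inE negb_and A0.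
  split=> [|x y]; rewrite !inE ?A1 ?B1 // => /andP[Ax Bx] /andP[Ay By].
  by rewrite AV ?BV.
- by move=> A []; apply: Hc.
- move=> _ /mapP[l /[!mem_primes]/and3P[l_pr _ l_n] ->]; split; first exact: divr_closed_roots.
  rewrite inE expr0n eqn0Ngt divn_gt0 ?prime_gt0 // dvdn_leq //=.
  by rewrite eq_sym oner_eq0.
- split; last by rewrite inE eqxx.
  split=> [|x y]; rewrite !inE ?oner_eq0 // => nx ny.
  by rewrite mulf_neq0 ?invr_neq0.
Qed.

End Primitive.

(** * Non-powers in sieved affine subspaces *)

Section AffineSieve.

Variable E : finFieldType.
Local Open Scope ring_scope.
Implicit Types A B T V H : {set E}.

(** Quantifying over the possible base points makes the empty set affine, so that
    affine sets are stable under intersection. *)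
Definition affine A : Prop :=
  exists2 V : {set E}, zmod_closed V & {in A, forall c, A = [set x | x - c \in V]}.

Lemma affine_coset V (c : E) : zmod_closed V -> affine [set x | x - c \in V].
Proof.
move=> Vz; exists V => // c'; rewrite inE => Vc'.
have [V0 VB] := Vz.
apply/setP=> x; rewrite !inE; apply/idP/idP=> [Vx|Vx].
  have -> : x - c' = (x - c) - (c' - c) by ring.
  exact: (VB _ _ Vx Vc').
have -> : x - c = (c' - c) - (0 - (x - c')) by ring.
exact: (VB _ _ Vc' (VB _ _ V0 Vx)).
Qed.

Lemma affine_zmod V : zmod_closed V -> affine V.
Proof.
move=> Vz; have := affine_coset 0 Vz; congr affine.
by apply/setP=> x; rewrite inE subr0.
Qed.

Lemma affineI A B : affine A -> affine B -> affine (A :&: B).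
Proof.
move=> [V [V0 VB] AV] [W [W0 WB] BW]; exists (V :&: W).
  split=> [|x y]; rewrite !inE ?V0 ?W0 // => /andP[Vx Wx] /andP[Vy Wy].
  by rewrite (VB _ _ Vx Vy) (WB _ _ Wx Wy).
move=> c; rewrite inE => /andP[Ac Bc].
by rewrite {1}(AV _ Ac) {1}(BW _ Bc); apply/setP=> x; rewrite !inE.
Qed.

Lemma sqr_discr_affine H A : divr_closed H -> 0 \notin H -> affine A ->
  discr A H ^+ 2 <= (#|E| ^ 3)%N%:Z.
Proof.
move=> Hd H0 [V Vz AV]; rewrite discrC.
have [A0|[c Ac]] := set_0Vmem A; last by rewrite (AV _ Ac) sqr_discr_subspace.
by rewrite A0 /discr setI0 cards0 !muln0 subrr expr0n.
Qed.

(** If no element of [T] were a non-power, the discrepancy of the non-powers and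
    [T] would be [- totient n * #|T|], against the bound obtained by sieving once
    over the primes and once over the subspaces in [Bs]. *)
Lemma non_powers_meet_affine A (Bs : seq {set E}) :
    affine A -> {in Bs, forall B, affine B} ->
    let T := A :\: \bigcup_(B <- Bs) B in
    (4 ^ size (primes #|E|.-1) * (4 ^ size Bs * #|E| ^ 3)
       < (totient #|E|.-1 * #|T|) ^ 2)%N ->
  exists2 x, x \in T & x \in non_powers E.
Proof.
move=> Aa Bsa T lt_T; apply/exists_inP.
apply: contraLR lt_T; rewrite negb_exists_in -leqNgt => /forall_inP noT.
have T0 : non_powers E :&: T = set0.
  apply/setP=> x; rewrite in_setI in_set0; apply/negP=> /andP[np_x Tx].
  by have /negP := noT x Tx.
rewrite -lez_nat.
have -> : ((totient #|E|.-1 * #|T|) ^ 2)%N%:Z = discr (non_powers E) T ^+ 2 :> int.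
  by rewrite /discr T0 cards0 muln0 sub0r sqrrN card_non_powers -rmorphXn.
rewrite PoszM [(_ ^ size Bs * _)%N%:Z]PoszM.
apply: sqr_discr_non_powers => H Hd H0; rewrite discrC /T.
have base C : affine C -> discr C H ^+ 2 <= (#|E| ^ 3)%N%:Z by apply: sqr_discr_affine.
exact: (sqr_discr_remove (@affineI) base Bsa Aa).
Qed.

End AffineSieve.

(** * Counting outside of a family of subspaces *)

Section RemoveSubspaces.

Variables (F : finFieldType) (L : fieldExtType F).
Local Open Scope ring_scope.
Local Notation q := #|F|.
Local Notation E := (finvect_type L).
Implicit Types (A T : {set E}) (U W : {vspace L}) (v : E).

Definition vset U : {set E} := [set x : E | x \in U].

Lemma card_vset U : #|vset U| = (q ^ \dim U)%N.
Proof.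
rewrite -(card_vspace (cvT := Vector.class (finvect_type L)) (U : {vspace E})).
by rewrite cardsE; apply: eq_card => x.
Qed.

Lemma zmod_vset U : zmod_closed (vset U).
Proof. by split=> [|x y]; rewrite !inE ?mem0v //; apply: memvB. Qed.

Definition invariant_along T v := forall x (c : F), x \in T -> x + c *: v \in T.

(** Each line in the direction [v] that meets [T] is contained in [T], and meets
    [W] in at most one point: a proportion at most [1 / q] of [T] is removed. *)
Lemma card_setD_vset T W v : invariant_along T v -> v \notin W ->
  ((q - 1) * #|T| <= q * #|T :\: vset W|)%N.
Proof.
move=> Tv vW.
suff: (q * #|T :&: vset W| <= #|T|)%N by rewrite -(cardsID (vset W) T); nia.
pose f (cw : F * E) : E := cw.2 + cw.1 *: v.
rewrite -cardsT -cardsX -(@card_in_imset _ _ f).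
  apply/subset_leq_card/subsetP => y /imsetP[[c w]].
  by rewrite !inE /= => /andP[Tw _] ->; apply: Tv.
move=> [c w] [c' w']; rewrite !inE /= => /andP[_ Ww] /andP[_ Ww'] eq_f.
have eq_v : (c - c') *: v = w' - w.
  by rewrite scalerBl; move/eqP: eq_f; rewrite /f /= -subr_eq => /eqP <-; ring.
have [eq_c|ne_c] := eqVneq c c'.
  by congr pair => //; move: eq_f; rewrite /f /= eq_c => /addIr.
case/negP: vW; rewrite -[v](scalerK (_ : c - c' != 0)) ?subr_eq0 //.
by rewrite eq_v memvZ ?memvB.
Qed.

(** The vector [v i] lies in all the subspaces to be removed but [W i], so that
    after the removal of the others the set is still invariant along [v i], and
    [card_setD_vset] applies once more. This stands in for the product structure
    of [A] that a full primary decomposition would give. *)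
Lemma card_remove_subspaces (I : eqType) (s : seq I) (W : I -> {vspace L})
    (v : I -> E) A :
    uniq s -> {in s, forall i, invariant_along A (v i)} ->
    {in s, forall i, v i \notin W i} ->
    {in s &, forall i j, i != j -> v i \in W j} ->
  ((q - 1) ^ size s * #|A|
     <= q ^ size s * #|A :\: \bigcup_(B <- [seq vset (W i) | i <- s]) B|)%N.
Proof.
elim: s => [|i s IH]; first by rewrite big_nil setD0.
case/andP=> i_s s_uniq Av vW vWj; rewrite /= big_cons setUC -setDDl.
have sub j : j \in s -> j \in i :: s by rewrite inE orbC => ->.
have {}IH := IH s_uniq (fun j js => Av j (sub j js)) (fun j js => vW j (sub j js))
  (fun j k js ks => vWj j k (sub j js) (sub k ks)).
move: IH; set T := A :\: _ => IH.
have Tv : invariant_along T (v i).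
  move=> x c; rewrite /T !in_setD => /andP[nUx Ax].
  rewrite Av ?mem_head // andbT; apply: contra nUx; rewrite !in_bigcup_seq !has_map.
  move=> /hasP[j js /=]; rewrite inE => Wjx; apply/hasP; exists j => //=.
  have vj : v i \in W j.
    by apply: vWj; rewrite ?mem_head ?sub //; apply: contraNneq i_s => ->.
  by rewrite inE -(addrK (c *: v i) x) memvB ?memvZ.
have := card_setD_vset Tv (vW i (mem_head _ _)).
move=> step; rewrite !expnS -mulnA.
apply: leq_trans (leq_mul (leqnn _) IH) _.
by rewrite mulnCA -mulnA [leqRHS]mulnCA leq_mul.
Qed.

Lemma dim_kernels (I : Type) (s : seq I) (f : I -> 'End(L)) (e : I -> nat) :
    (forall i, (\dim (limg (f i)) <= e i)%N) ->
  (\dim {:L} <= \dim (\bigcap_(i <- s) lker (f i)) + \sum_(i <- s) e i)%N.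
Proof.
move=> fe; elim: s => [|i s IH]; first by rewrite !big_nil addn0.
rewrite !big_cons capvC; set U := (\bigcap_(j <- s) _)%VS in IH *.
apply: leq_trans IH _; rewrite -(limg_ker_dim (f i) U) addnA leq_add2r.
rewrite leq_add2l; apply: leq_trans (fe i).
by apply: dimvS; apply: limgS; apply: subvf.
Qed.

End RemoveSubspaces.

(** * Monic irreducible factors *)

Section IrreducibleFactors.

Variable F : finFieldType.
Local Open Scope ring_scope.
Implicit Types (p P : {poly F}) (ps : seq {poly F}).

Definition monic_irreducible P := (P \is monic) && irreducibleb P.

Lemma monic_irreducible_factor p :
  (1 < size p)%N -> exists2 P, monic_irreducible P & P %| p.
Proof.
have [n] := ubnP (size p); elim: n p => // n IH p le_pn p_gt1.
have [/irreducibleP p_irr|] := boolP (irreducibleb p).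
  have nz_p : lead_coef p != 0 by rewrite lead_coef_eq0 -size_poly_gt0 ltnW.
  exists ((lead_coef p)^-1 *: p); last by rewrite dvdpZl ?invr_eq0.
  rewrite /monic_irreducible monicE lead_coefZ mulVf // eqxx /=.
  apply/irreducibleP; have eqpp : (lead_coef p)^-1 *: p %= p by rewrite eqp_scale ?invr_eq0.
  split=> [|q q_n1]; first by rewrite (eqp_size eqpp).
  by rewrite (eqp_dvdr _ eqpp) (eqp_rtrans eqpp) => /p_irr; apply.
rewrite /irreducibleb p_gt1 /= negb_forall => /existsP[/= q].
rewrite negb_imply -ltnNge -Pdiv.Idomain.dvdpE => /andP[q_p q_gt1].
have lt_qp : (size q < size p)%N.
  by rewrite (leq_ltn_trans (size_npoly q)) // ltn_predL ltnW.
have [|P P_irr P_q] := IH q _ q_gt1; first by rewrite (leq_trans lt_qp).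
by exists P => //; apply: dvdp_trans q_p.
Qed.

Lemma monic_irreducible_size P : monic_irreducible P -> (1 < size P)%N.
Proof. by case/andP=> _ /andP[]. Qed.

Lemma monic_irreducible_factors p : p \is monic ->
  exists2 ps, all monic_irreducible ps & p = \prod_(P <- ps) P.
Proof.
have [n] := ubnP (size p); elim: n p => // n IH p le_pn p_mon.
have [p_le1|p_gt1] := leqP (size p) 1.
  exists [::]; rewrite // big_nil; move: p_mon; rewrite (size1_polyC p_le1).
  by rewrite monicE lead_coefC => /eqP->.
have [P P_irr P_p] := monic_irreducible_factor p_gt1.
have [P_mon _] := andP P_irr; have P_gt1 := monic_irreducible_size P_irr.
have Ep : p = p %/ P * P by rewrite divpK.
have g_mon : p %/ P \is monic by rewrite -(monicMr _ P_mon) -Ep.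
have [|ps ps_irr Eg] := IH _ _ g_mon.
  rewrite -ltnS (leq_trans _ le_pn) // ltnS size_divp ?monic_neq0 //.
  by rewrite ltn_subrL -subn1 subn_gt0 P_gt1 size_poly_gt0 monic_neq0.
by exists (P :: ps); rewrite /= ?P_irr // big_cons -Eg mulrC.
Qed.

Lemma monic_irreducible_coprime P P' : monic_irreducible P ->
  monic_irreducible P' -> P != P' -> coprimep P P'.
Proof.
move=> /andP[Pm /irreducibleP Pi] /andP[Pm' /irreducibleP Pi'] neq.
rewrite irreducible_poly_coprime //; apply: contra neq => P_P'.
rewrite -eqp_monic //; apply: Pi' => //.
by case: Pi; case: (size P) => [|[]].
Qed.

Lemma separable_factors_uniq ps : all monic_irreducible ps ->
  separable_poly (\prod_(P <- ps) P) -> uniq ps.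
Proof.
elim: ps => //= P ps IH /andP[P_irr ps_irr]; rewrite big_cons => sep.
rewrite IH //; last exact: dvdp_separable (dvdp_mulIr _ _) sep.
rewrite andbT; apply: contraL (separable_coprime sep (dvdpp _)) => P_ps.
rewrite irreducible_poly_coprime; last by case/andP: P_irr => _ /irreducibleP.
by rewrite negbK (big_rem P) //= dvdp_mulIl.
Qed.

Lemma factors_degree ps : all monic_irreducible ps ->
  (size (\prod_(P <- ps) P)).-1 = (\sum_(P <- ps) (size P).-1)%N.
Proof.
elim: ps => [|P ps IH] /=; first by rewrite !big_nil size_poly1.
case/andP=> P_irr ps_irr; rewrite !big_cons -IH //.
have mon s : all monic_irreducible s -> \prod_(P <- s) P \is monic.
  by move=> s_irr; rewrite big_seq monic_prod // => R /(allP s_irr)/andP[].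
have := mon _ ps_irr; set g := \prod_(_ <- _) _ => g_mon.
have P_mon : P \is monic by case/andP: P_irr.
rewrite size_monicM ?monic_neq0 //.
have := monic_irreducible_size P_irr.
have : (0 < size g)%N by rewrite size_poly_gt0 monic_neq0.
by case: (size P) (size g) => [|[|a]] [|b] //= _ _; lia.
Qed.

(** Nonlinear factors have degree at least 2, and there are at most [q] monic
    linear polynomials. The second bound is what makes small [q] tractable: with
    [r] close to [m] the factor [4 ^ r] would be too large there. *)
Lemma factors_count ps : all monic_irreducible ps -> uniq ps ->
  let m := (size (\prod_(P <- ps) P)).-1 in
  (size ps <= m)%N /\ (2 * size ps <= m + #|F|)%N.
Proof.
move=> ps_irr ps_uniq m; rewrite {}/m factors_degree //.
have deg_gt0 P : P \in ps -> (0 < (size P).-1)%N.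
  by move=> /(allP ps_irr)/monic_irreducible_size; case: (size P) => [|[]].
split; first by rewrite -sum1_size !big_seq leq_sum.
pose lin := [seq P : {poly F} <- ps | size P == 2%N].
have lin_le : (size lin <= #|F|)%N.
  rewrite cardE -(size_map (fun P : {poly F} => P`_0)) uniq_leq_size //; last first.
    by move=> x _; rewrite mem_enum.
  rewrite map_inj_in_uniq ?filter_uniq // => P P'; rewrite !mem_filter.
  move=> /andP[/eqP sP /(allP ps_irr)/andP[mP _]].
  move=> /andP[/eqP sP' /(allP ps_irr)/andP[mP' _]] eq0.
  apply/polyP => -[|[|i]] //; last by rewrite !nth_default ?sP ?sP'.
  by move: mP mP'; rewrite !monicE /lead_coef sP sP' => /eqP-> /eqP->.
apply: leq_trans (leq_add (leqnn _) lin_le).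
rewrite size_filter -sum1_count [X in (_ <= _ + X)%N]big_mkcond.
rewrite -sum1_size big_distrr -big_split /= !big_seq leq_sum // => P /deg_gt0.
by have [->|] := eqVneq (size P) 2; case: (size P) => [|[|[]]].
Qed.

End IrreducibleFactors.

(** * The action of polynomials through the Frobenius endomorphism *)

Section FrobeniusModule.

Import FalgLfun.

Variables (F : finFieldType) (L : fieldExtType F).
Local Open Scope ring_scope.
Local Notation q := #|F|.
Local Notation m := (\dim {:L}).
Implicit Types (p : {poly F}) (x y : L).

Lemma frobeniusD x y : (x + y) ^+ q = x ^+ q + y ^+ q.
Proof.
apply: exprDn_pchar; have [r r_pr r_char] := finPcharP F.
have r_L : r \in [pchar L] by rewrite (pchar_lalg L).
rewrite (eq_pnat _ (pcharf_eq r_L)).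
have := fin_ring_pchar_abelem r_char; move=> /abelem_pgroup.
by rewrite /pgroup cardsT.
Qed.

Definition frobenius x := x ^+ q.

Lemma frobenius_linear : linear frobenius.
Proof. by move=> a x y; rewrite /frobenius frobeniusD exprZn expf_card. Qed.

HB.instance Definition _ :=
  GRing.isLinear.Build F L L _ frobenius frobenius_linear.

Definition frob_end : 'End(L) := linfun frobenius.

(** [L] as a module over [F[X]], with [X] acting as the Frobenius endomorphism:
    [act p x] is the value at [x] of the linearized polynomial attached to [p]. *)
Definition act_end p : 'End(L) := horner_alg frob_end p.
Definition act p x : L := act_end p x.

Lemma act_linear p : linear (act p).
Proof. by move=> a x y; rewrite /act /act_end linearP. Qed.

HB.instance Definition _ p := GRing.isLinear.Build F L L _ (act p) (act_linear p).

Lemma actD p1 p2 x : act (p1 + p2) x = act p1 x + act p2 x.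
Proof. by rewrite /act /act_end rmorphD /= add_lfunE. Qed.

Lemma actN p x : act (- p) x = - act p x.
Proof. by rewrite /act /act_end rmorphN /= opp_lfunE. Qed.

Lemma actM p1 p2 x : act (p1 * p2) x = act p1 (act p2 x).
Proof. by rewrite /act /act_end mulrC rmorphM /= lfun_mulE. Qed.

Lemma act1 x : act 1 x = x.
Proof. by rewrite /act /act_end rmorph1 id_lfunE. Qed.

Lemma actXn i x : act 'X^i x = x ^+ (q ^ i).
Proof.
elim: i => [|i IH]; first by rewrite expr0 act1 expn0 expr1.
rewrite exprS actM IH {1}/act /act_end horner_algX lfunE /= /frobenius.
by rewrite -exprM -expnSr.
Qed.

Lemma act_sum (I : Type) (r : seq I) (P : pred I) (f : I -> {poly F}) x :
  act (\sum_(i <- r | P i) f i) x = \sum_(i <- r | P i) act (f i) x.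
Proof. by rewrite /act /act_end rmorph_sum /= sum_lfunE. Qed.

Lemma actZ (c : F) p x : act (c *: p) x = c *: act p x.
Proof. by rewrite /act /act_end linearZ /= mulr_algl scale_lfunE. Qed.

Lemma act_poly n (c : nat -> F) x :
  act (\poly_(i < n) c i) x = \sum_(i < n) c i *: x ^+ (q ^ i).
Proof.
by rewrite poly_def act_sum; apply: eq_bigr => i _; rewrite actZ actXn.
Qed.

Lemma actE p x : act p x = \sum_(i < size p) p`_i *: x ^+ (q ^ i).
Proof. by rewrite -{1}(coefK p) act_poly. Qed.

Lemma mem_subfield_act (K : {subfield L}) x :
  (x \in K) = (act ('X^(\dim K) - 1) x == 0).
Proof. by rewrite Fermat's_little_theorem actD actN actXn act1 subr_eq0. Qed.

Lemma act_XmB1 x : act ('X^m - 1) x = 0.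
Proof. by apply/eqP; rewrite -(mem_subfield_act {:L}%AS) memvf. Qed.

Lemma q_gt1 : (1 < q)%N. Proof. exact: finNzRing_gt1. Qed.

Lemma card_ext : #|finvect_type L| = (q ^ m)%N.
Proof.
by rewrite -(card_vspace (cvT := Vector.class (finvect_type L))) card_vspacef.
Qed.

(** A linearized polynomial of degree at most [q ^ (m - 1)] has fewer roots than
    [L] has elements: the annihilator of [L] is generated by [X^m - 1]. *)
Lemma act_neq0 p : p != 0 -> (size p <= m)%N -> exists x, act p x != 0.
Proof.
move=> nz_p le_pm; pose E := finvect_type L.
suff /existsP[x nz_x] : [exists x : E, act p x != 0] by exists x.
apply: contraT; rewrite negb_exists => /forallP/= act_0.
pose g : {poly E} := \sum_(i < size p) ((p`_i)%:A : E) *: 'X^(q ^ i).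
have sz_p : (0 < size p)%N by rewrite size_poly_gt0.
have nz_g : g != 0.
  apply: contraTneq (nz_p) => g0; rewrite negbK -lead_coef_eq0 lead_coefE.
  have k_lt : ((size p).-1 < size p)%N by rewrite prednK.
  have /eqP : g`_(q ^ (size p).-1) = 0 by rewrite g0 coef0.
  rewrite /g coef_sum (bigD1 (Ordinal k_lt)) //= big1 => [|i ne_i].
    by rewrite addr0 coefZ coefXn eqxx mulr1 scaler_eq0 oner_eq0 orbF.
  rewrite coefZ coefXn eqn_exp2l ?q_gt1 // eq_sym -(inj_eq val_inj) /= in ne_i *.
  by rewrite (negPf ne_i) mulr0.
have sz_g : (size g <= (q ^ m.-1).+1)%N.
  apply: leq_trans (size_sum _ _ _) _; apply/bigmax_leqP => i _.
  apply: leq_trans (size_scale_leq _ _) _; rewrite size_polyXn ltnS.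
  rewrite leq_exp2l ?q_gt1 // -ltnS prednK ?adim_gt0 //.
  exact: leq_trans (ltn_ord i) _.
have all_g : all (root g) (enum E).
  apply/allP => x _; rewrite rootE /g horner_sum.
  apply/eqP; transitivity (act p x); last by apply/eqP; have := act_0 x; rewrite negbK.
  rewrite actE; apply: eq_bigr => i _.
  by rewrite hornerZ hornerXn -[RHS]mulr_algl.
have := max_poly_roots nz_g all_g (enum_uniq _); rewrite -cardE card_ext.
rewrite ltnNge (leq_trans sz_g) // ltn_exp2l ?q_gt1 // ltn_predL.
by rewrite adim_gt0.
Qed.

End FrobeniusModule.

(** * Traces and the existence of prescribed traces *)

Section Traces.

Variables (F : finFieldType) (L : fieldExtType F).
Local Open Scope ring_scope.
Local Notation q := #|F|.
Local Notation m := (\dim {:L}).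

Definition trpoly n d : {poly F} := \sum_(i < (n %/ d)%N) 'X^(i * d).

Lemma Tr_act n d (x : L) : Tr n d x = act (trpoly n d) x.
Proof. by rewrite /Tr act_sum; apply: eq_bigr => i _; rewrite actXn. Qed.

Lemma trpolyP n d : (d %| n)%N -> trpoly n d * ('X^d - 1) = 'X^n - 1.
Proof.
move=> d_n; rewrite -{2}(divnK d_n) mulnC exprM [RHS]subrX1 [RHS]mulrC; congr (_ * _).
by apply: eq_bigr => i _; rewrite mulnC exprM.
Qed.

Lemma sum_periodic (h : nat -> L) r e : (forall s, h (s + e)%N = h s) ->
  \sum_(s < r * e) h s = r%:R *: \sum_(s < e) h s.
Proof.
move=> h_per; elim: r => [|r IH]; first by rewrite big_ord0 scale0r.
rewrite mulSn big_split_ord /= -addn1 natrD scalerDl scale1r addrC -IH.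
congr (_ + _); apply: eq_bigr => s _; by rewrite addnC h_per.
Qed.

(** On a subfield of degree [e] the exponents [i] of the conjugations
    [x |-> x ^ (q ^ i)] matter only modulo [e]; as [d] is prime to [e], the
    multiples of [d] run through all residues, each equally often. *)
Lemma Tr_coprime_subfield (K : {subfield L}) n d x :
    coprime d (\dim K) -> (d * \dim K %| n)%N -> x \in K ->
  Tr n d x = (n %/ (d * \dim K))%:R *: Tr (\dim K) 1 x.
Proof.
set e := \dim K => co_de de_n Kx; have e_gt0 : (0 < e)%N by apply: adim_gt0.
pose g t := x ^+ (q ^ t).
have g_per t : g (t + e)%N = g t.
  have := Kx; rewrite Fermat's_little_theorem -/e => /eqP xe.
  by rewrite /g addnC expnD exprM xe.
have g_mod t : g t = g (t %% e)%N.
  rewrite {1}(divn_eq t e); elim: (t %/ e)%N => [|j IH]; first by rewrite mul0n.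
  by rewrite mulSn -addnA addnC g_per.
rewrite /Tr divn1; under [in RHS]eq_bigr do rewrite muln1.
have [d0|d_gt0] := posnP d.
  by rewrite d0 mul0n !divn0 big_ord0 scale0r.
case/dvdnP: de_n => k ->; rewrite mulnK ?muln_gt0 ?d_gt0 //.
have -> : (k * (d * e) %/ d = k * e)%N by rewrite mulnCA mulKn.
rewrite (@sum_periodic (fun s => x ^+ (q ^ (s * d)))); last first.
  move=> s; change (g ((s + e) * d)%N = g (s * d)%N).
  by rewrite [LHS]g_mod [RHS]g_mod mulnDl addnC (mulnC e) modnMDl.
congr (_ *: _); have lt_e (s : 'I_e) : (s * d %% e < e)%N by rewrite ltn_pmod.
pose f s := Ordinal (lt_e s).
have f_inj : injective f.
  move=> s t [] eq_st; apply/val_inj; wlog le_st : s t eq_st / (s <= t)%N.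
    by move=> IH; have [/IH|/ltnW/IH] := leqP s t; [apply|move=> ->].
  move/esym/eqP: eq_st; rewrite eqn_mod_dvd ?leq_mul // -mulnBl Gauss_dvdl 1?coprime_sym //.
  rewrite /dvdn modn_small ?subn_eq0; last by rewrite (leq_ltn_trans (leq_subr _ _)).
  by move=> le_ts; apply/eqP; rewrite eqn_leq le_st.
rewrite [RHS](reindex_inj f_inj); apply: eq_bigr => s _.
by change (g (s * d)%N = g (s * d %% e)%N).
Qed.

Lemma Tr_subfield (K : {subfield L}) n x : x \in K ->
  Tr n (\dim K) x = (n %/ \dim K)%:R *: x.
Proof.
rewrite Fermat's_little_theorem => /eqP xK; rewrite /Tr scaler_nat.
rewrite -[X in _ *+ X]card_ord -sumr_const; apply: eq_bigr => -[i _] _ /=.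
elim: i => [|i IH]; first by rewrite mul0n expr1.
by rewrite mulSn expnD exprM xK.
Qed.

(** The characteristic divides [q]: Bezout's identity for [n] and [q] would read
    [1 = 0] if [n] vanished in [F]. *)
Lemma natr_neq0 n : coprime n q -> n%:R != 0 :> F.
Proof.
move=> co_nq; have q0 : q%:R = 0 :> F.
  by apply/eqP; rewrite -FinRing.zmodXgE -order_dvdn -cardsT order_dvdG ?inE.
apply/eqP => n0; have n_gt0 : (0 < n)%N.
  case: n co_nq {n0} => //; rewrite /coprime gcd0n => /eqP q1.
  by have := finNzRing_gt1 F; rewrite q1.
have [u v Euv _] := egcdnP q n_gt0.
have := congr1 (fun k => k%:R : F) Euv.
rewrite (eqP co_nq : gcdn n q = 1%N) natrD !natrM n0 q0 !mulr0 add0r => /eqP.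
by rewrite eq_sym oner_eq0.
Qed.

(** Let [c] be the common trace of the [a j] to [F]. The trace
    onto the [i]-th subfield of [(d j / m) a j] is [a i] if [j = i], and
    [c / d i] otherwise, by [Tr_coprime_subfield]. The last term of the witness
    has trace [(k - 1) c / d i] when there are [k] subfields, and cancels the
    contributions of the [j != i]. *)
Lemma exists_traces k (d : 'I_k -> nat) (K : 'I_k -> {subfield L}) (a : 'I_k -> L) :
    coprime m q ->
    (forall i, \dim (K i) = d i) -> (forall i, d i %| m)%N ->
    (forall i j, i != j -> coprime (d i) (d j)) ->
    (forall i, a i \in K i) ->
    (forall i j, Tr (d i) 1 (a i) = Tr (d j) 1 (a j)) ->
  exists x, forall i, Tr m (d i) x = a i.
Proof.
move=> co_mq dimK d_m co_d Ka Tra.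
case: k d K a dimK d_m co_d Ka Tra => [|k] d K a dimK d_m co_d Ka Tra.
  by exists 0 => -[].
(* From here on there are [k.+1] subfields, so that [k] is their number less
   one. *)
have nz_m : m%:R != 0 :> F by apply: natr_neq0.
pose c := Tr (d ord0) 1 (a ord0).
have d_gt0 i : (0 < d i)%N by rewrite -dimK adim_gt0.
have c1 : c \in 1%AS.
  rewrite mem_subfield_act dimv1 /c Tr_act -actM mulrC trpolyP ?dvd1n //.
  by rewrite -dimK -mem_subfield_act.
pose f i : F := (m %/ d i)%:R.
have df i : (d i)%:R * f i = m%:R :> F by rewrite -natrM mulnC divnK.
exists (\sum_j ((d j)%:R / m%:R) *: a j - (k%:R / m%:R) *: c) => i.
rewrite Tr_act raddfB raddf_sum /= linearZ /=.
have -> : act (trpoly m (d i)) c = f i *: c.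
  rewrite -Tr_act (Tr_coprime_subfield _ _ c1) dimv1 ?coprimen1 ?muln1 //.
  by rewrite /Tr big_ord1 mul0n expn0 expr1.
rewrite (bigD1 i) //= linearZ /= -Tr_act.
have -> : Tr m (d i) (a i) = f i *: a i by rewrite /f -dimK Tr_subfield.
rewrite scalerA mulrAC df divff // scale1r -addrA.
rewrite (eq_bigr (fun=> ((m %/ d i)%:R / m%:R) *: c)); last first.
  move=> j ne_ji; rewrite linearZ /= -Tr_act.
  rewrite (Tr_coprime_subfield _ _ (Ka j)) ?dimK; first last.
  - by rewrite Gauss_dvd ?d_m // co_d // eq_sym.
  - by rewrite co_d // eq_sym.
  rewrite (Tra j ord0) scalerA mulrAC -natrM; congr ((_%:R / _) *: _).
  by rewrite divnMA mulnC divnK // dvdn_divRL // mulnC Gauss_dvd ?d_m // co_d // eq_sym.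
rewrite sumr_const (_ : #|_| = k); last first.
  by rewrite -[k in RHS]/(k.+1.-1) -[in RHS](card_ord k.+1) -(cardC1 i); apply: eq_card.
rewrite scalerA -scaler_nat scalerA mulrAC mulrA subrr addr0 //.
Qed.

End Traces.

(** * Normality and the factors of [X^m - 1] *)

Section Normality.

Variables (F : finFieldType) (L : fieldExtType F).
Local Open Scope ring_scope.
Local Notation q := #|F|.
Local Notation m := (\dim {:L}).
Local Notation Xm1 := ('X^m - 1 : {poly F}).

Lemma act_normal (K : {vspace L}) x (p : {poly F}) :
  is_normal K x -> p != 0 -> (size p <= \dim K)%N -> act p x != 0.
Proof.
move=> /andP[_ x_free] nz_p le_p; apply: contra nz_p => /eqP px0.
pose X := [tuple x ^+ (q ^ i) | i < \dim K].
have XE (j : 'I_(\dim K)) : X`_j = x ^+ (q ^ j) by rewrite -tnth_nth tnth_mktuple.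
have freeX : free X.
  rewrite (_ : tval X = [seq x ^+ (q ^ i) | i <- iota 0 (\dim K)]) //.
  by rewrite /= -val_enum_ord -map_comp.
apply/eqP/polyP => i; rewrite coef0.
have [lt_i|ge_i] := ltnP i (\dim K); last by rewrite nth_default // (leq_trans le_p).
suff p0 : \sum_(j < \dim K) p`_j *: X`_j = 0.
  by move/freeP: freeX => /(_ (fun j : 'I_(\dim K) => p`_j) p0 (Ordinal lt_i)).
rewrite -[RHS]px0 actE (big_ord_widen _ (fun i => p`_i *: x ^+ (q ^ i)) le_p).
rewrite [RHS]big_mkcond; apply: eq_bigr => j _.
rewrite XE; case: ltnP => // le_j.
by rewrite nth_default // scale0r.
Qed.

Lemma normal_of_act (x : L) :
    (forall p : {poly F}, p != 0 -> (size p <= m)%N -> act p x != 0) ->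
  is_normal {:L} x.
Proof.
move=> nz_act; rewrite /is_normal basisEfree subvf size_map size_iota leqnn !andbT.
rewrite -val_enum_ord -map_comp.
pose X := [tuple x ^+ (q ^ i) | i < m].
have XE (j : 'I_m) : X`_j = x ^+ (q ^ j) by rewrite -tnth_nth tnth_mktuple.
rewrite -[X in free X]/(tval X).
apply/freeP => k k0; pose p := \poly_(i < m) (if insub i is Some j then k j else 0).
have p_k (i : 'I_m) : p`_i = k i by rewrite coef_poly ltn_ord valK.
have p0 : p = 0.
  apply: contraTeq isT => nz_p; have := nz_act p nz_p (size_poly _ _).
  rewrite act_poly => /negP[]; apply/eqP; rewrite -[RHS]k0.
  by apply: eq_bigr => i _; rewrite valK XE.
by move=> i; rewrite -p_k p0 coef0.
Qed.

Variable ps : seq {poly F}.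
Hypotheses (ps_irr : all (@monic_irreducible F) ps).
Hypotheses (Eps : Xm1 = \prod_(P <- ps) P).

Lemma Xm1_neq0 : Xm1 != 0.
Proof. by rewrite -size_poly_gt0 size_XnsubC ?adim_gt0. Qed.

Lemma factor_dvd P : P \in ps -> P %| Xm1.
Proof. by move=> P_ps; rewrite Eps (big_rem P) //= dvdp_mulIl. Qed.

Lemma factor_irr P : P \in ps -> monic_irreducible P.
Proof. exact: (allP ps_irr). Qed.

Lemma irreducible_mem_factors P : monic_irreducible P -> P %| Xm1 -> P \in ps.
Proof.
move=> P_irr; rewrite Eps; apply: contraTT => P_ps.
rewrite -irreducible_poly_coprime; last by case/andP: P_irr => _ /irreducibleP.
rewrite big_seq; apply: (big_rec (fun g => coprimep P g)) => [|R g R_ps co_g].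
  by rewrite coprimep1.
rewrite coprimepMr co_g andbT monic_irreducible_coprime ?(factor_irr R_ps) //.
by apply: contraNneq P_ps => ->.
Qed.

(** If [p] kills [x], so does its gcd with [X^m - 1], hence so does
    [(X^m - 1) / P] for any irreducible factor [P] of the cofactor of this gcd. *)
Lemma normal_of_factors (x : L) :
  {in ps, forall P, act (Xm1 %/ P) x != 0} -> is_normal {:L} x.
Proof.
move=> nz_ps; apply: normal_of_act => p nz_p le_p; apply/eqP => px0.
have gx0 : act (gcdp p Xm1) x = 0.
  have [[u v] /= /eqpP[[c1 c2] /= /andP[nz1 nz2] Euv]] := Bezoutp p Xm1.
  have := congr1 (fun g => act g x) Euv.
  rewrite !actZ actD !actM px0 act_XmB1 !linear0 addr0 scaler0.
  by move/esym/eqP; rewrite scaler_eq0 (negPf nz2) => /eqP.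
set g := gcdp p Xm1 in gx0; have g_Xm : g %| Xm1 by apply: dvdp_gcdr.
have le_g : (size g <= m)%N.
  by apply: leq_trans le_p; apply: dvdp_leq => //; apply: dvdp_gcdl.
have nz_g : g != 0 by apply: contraNneq Xm1_neq0 => g0; rewrite -dvd0p -g0.
have gt1 : (1 < size (Xm1 %/ g)%R)%N.
  rewrite size_divp // size_XnsubC ?adim_gt0 //.
  by case: (size g) le_g (size_poly_gt0 g) => [|b]; rewrite ?nz_g //= => *; lia.
have [P P_irr P_h] := monic_irreducible_factor gt1.
have P_ps : P \in ps.
  apply: irreducible_mem_factors => //; apply: dvdp_trans P_h _.
  by rewrite -{2}(divpK g_Xm) dvdp_mulr.
have nz_P : P != 0 by case/andP: P_irr => /monic_neq0.
case/negP: (nz_ps P P_ps); rewrite -{1}(divpK g_Xm) -{1}(divpK P_h).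
by rewrite mulrAC mulpK // actM gx0 linear0.
Qed.

Hypothesis sep : separable_poly Xm1.

Lemma factor_cofactor_coprime P : P \in ps -> coprimep P (Xm1 %/ P).
Proof.
move=> P_ps; by apply: (separable_coprime sep); rewrite mulrC divpK ?dvdpp ?(factor_dvd P_ps).
Qed.

(** A nonzero vector of the [P]-primary component: such vectors are the values
    of the cofactor of [P], and are not killed by this cofactor because it is
    prime to [P]. *)
Lemma exists_factor_vector P : P \in ps -> exists v : L,
  (act P v == 0) && (act (Xm1 %/ P) v != 0).
Proof.
move=> P_ps; have P_irr := factor_irr P_ps; have P_gt1 := monic_irreducible_size P_irr.
have nz_P : P != 0 by case/andP: P_irr => /monic_neq0.
have nz_g : Xm1 %/ P != 0 by rewrite dvdp_div_eq0 ?(factor_dvd P_ps) // Xm1_neq0.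
have [|y nz_y] := @act_neq0 F L _ nz_g.
  rewrite size_divp // size_XnsubC ?adim_gt0 //; move: P_gt1.
  by case: (size P) => [|[|b]] //= _; lia.
set v := act _ y in nz_y; have Pv : act P v = 0.
  by rewrite /v -actM mulrC divpK ?(factor_dvd P_ps) // act_XmB1.
exists v; rewrite Pv eqxx /=.
apply/eqP => gv0; have [[u w] /= /eqpP[[c1 c2] /= /andP[nz1 nz2] Euv]] :=
  Bezoutp P (Xm1 %/ P).
have := factor_cofactor_coprime P_ps; rewrite /coprimep => /size_poly1P[c nz_c Eg].
have := congr1 (fun g => act g v) Euv; rewrite Eg !actZ actD !actM Pv gv0 !linear0.
rewrite addr0 scaler0 -alg_polyC actZ act1 => /esym/eqP.
by rewrite !scaler_eq0 (negPf nz2) (negPf nz_c) (negPf nz_y).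
Qed.

End Normality.

(** * A counting criterion for prescribed traces *)

Section Criterion.

Variables (F : finFieldType) (L : fieldExtType F).
Local Open Scope ring_scope.
Local Notation q := #|F|.
Local Notation m := (\dim {:L}).
Local Notation E := (finvect_type L).

Lemma separable_XmB1 : coprime m q -> separable_poly ('X^m - 1 : {poly F}).
Proof. by move=> co_mq; apply: separable_Xn_sub_1; apply: natr_neq0. Qed.

(** The bound is required for every possible number [r] of irreducible factors of
    [X^m - 1] that divide no [X^(d i) - 1], since [r] depends on [F] and [L] in
    an irregular way. *)
Lemma prescribed_traces_criterion k (d : 'I_k -> nat)
    (K : 'I_k -> {subfield L}) (a : 'I_k -> L) :
    coprime m q ->
    (forall i, \dim (K i) = d i) -> (forall i, d i %| m)%N ->
    (forall i j, i != j -> coprime (d i) (d j)) ->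
    (forall i, a i \in K i) -> (forall i, is_normal (K i) (a i)) ->
    (forall i j, Tr (d i) 1 (a i) = Tr (d j) 1 (a j)) ->
    (forall r, (r <= m)%N -> (2 * r <= m + q)%N ->
       4 ^ (size (primes (q ^ m).-1) + r) * q ^ (3 * m)
         * q ^ (2 * (r + \sum_i d i))
       < (totient (q ^ m).-1 * ((q - 1) ^ r * q ^ m)) ^ 2)%N ->
  exists x : L, [/\ is_primitive x, is_normal {:L} x &
    forall i, Tr m (d i) x = a i].
Proof.
move=> co_mq dimK d_m co_d Ka a_norm Tra bound.
have [x0 Tr_x0] := exists_traces co_mq dimK d_m co_d Ka Tra.
have Xm_mon : 'X^m - 1 \is @monic F by rewrite monicXnsubC ?adim_gt0.
have [ps ps_irr Eps] := monic_irreducible_factors Xm_mon.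
have sep := separable_XmB1 co_mq.
have ps_uniq : uniq ps by apply: separable_factors_uniq => //; rewrite -Eps.
have := factors_count ps_irr ps_uniq; rewrite -Eps size_XnsubC ?adim_gt0 //=.
move=> [le_psm le_psq].
(* For [P] in [free_ps], a vector [v P] of the [P]-primary component has all its
   prescribed traces equal to zero, as [P] divides [trpoly m (d i)]. *)
pose fixed (P : {poly F}) := [exists i, P %| 'X^(d i) - 1].
pose free_ps := [seq P <- ps | ~~ fixed P].
have free_sub P : P \in free_ps -> P \in ps by rewrite mem_filter => /andP[].
have le_free : (size free_ps <= size ps)%N by rewrite size_filter count_size.
set r := size free_ps in le_free.
pose f i := act_end L (trpoly F m (d i)).
pose V0 := (\bigcap_i lker (f i))%VS.
have V0P x : reflect (forall i, act (trpoly F m (d i)) x = 0) (x \in V0).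
  rewrite memvE; apply: (iffP subv_bigcapP) => [V0x i|V0x i _].
    by have := V0x i isT; rewrite -memvE memv_ker => /eqP.
  by rewrite -memvE memv_ker; apply/eqP/V0x.
have dimV0 : (m <= \dim V0 + \sum_i d i)%N.
  apply: dim_kernels => i; rewrite -dimK; apply: dimvS.
  apply/subvP => _ /memv_imgP[y _ ->]; rewrite mem_subfield_act dimK.
  by rewrite -[f i y]/(act _ y) -actM mulrC trpolyP ?act_XmB1.
pose W P := lker (act_end L (('X^m - 1) %/ P)).
have WP P x : (x \in W P) = (act (('X^m - 1) %/ P) x == 0) by rewrite memv_ker.
pose A : {set E} := [set x : E | x - (x0 : E) \in vset V0].
have cardA : #|A| = (q ^ \dim V0)%N.
  rewrite -card_vset -(card_imset (vset V0) (addIr (x0 : E))); apply: eq_card => x.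
  rewrite inE; apply/idP/imsetP => [Vx|[y Vy ->]]; last by rewrite addrK.
  by exists (x - (x0 : E)) => //; rewrite subrK.
pose v (P : {poly F}) : E :=
  odflt 0 [pick v : E | (act P v == 0) && (act (('X^m - 1) %/ P) v != 0)].
have vP P : P \in ps -> (act P (v P) == 0) && (act (('X^m - 1) %/ P) (v P) != 0).
  move=> P_ps; rewrite /v; case: pickP => //= none.
  have [y Hy] := @exists_factor_vector F L ps ps_irr Eps sep P P_ps.
  by have := none y; rewrite Hy.
pose T := A :\: \bigcup_(B <- [seq vset (W P) | P <- free_ps]) B.
have coprime_fixed P i : P \in free_ps -> coprimep P ('X^(d i) - 1).
  rewrite mem_filter negb_exists => /andP[/forallP/(_ i) nPi P_ps].
  rewrite irreducible_poly_coprime //.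
  by case/andP: (factor_irr ps_irr P_ps) => _ /irreducibleP.
have dvd_trpoly P i : P \in free_ps -> P %| trpoly F m (d i).
  move=> P_free; rewrite -(Gauss_dvdpl _ (coprime_fixed P i P_free)) trpolyP //.
  exact: factor_dvd Eps _ (free_sub _ P_free).
have act_dvd (P R : {poly F}) (y : L) : act P y = 0 -> P %| R -> act R y = 0.
  by move=> Py /dvdpP[R' ->]; rewrite actM Py linear0.
have v0 P : P \in free_ps -> act P (v P) = 0.
  by move=> /free_sub/vP/andP[/eqP].
have card_T : ((q - 1) ^ r * #|A| <= q ^ r * #|T|)%N.
  apply: (card_remove_subspaces (v := v)); first exact: filter_uniq.
  - move=> P P_free x c; rewrite !inE => /V0P Vx; apply/V0P => i.
    have -> : x + c *: v P - x0 = (x - x0) + c *: v P by rewrite addrAC.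
    rewrite linearD linearZ /= Vx (act_dvd P) ?scaler0 ?addr0 //; first exact: v0.
    exact: dvd_trpoly.
  - by move=> P /free_sub/vP/andP[_]; rewrite WP.
  move=> P R P_free R_free ne_PR; rewrite WP; apply/eqP/(act_dvd P); first exact: v0.
  have P_ps := free_sub _ P_free; have R_ps := free_sub _ R_free.
  have co_PR : coprimep P R.
    by apply: monic_irreducible_coprime => //; apply: (factor_irr ps_irr).
  by rewrite -(Gauss_dvdpl _ co_PR) divpK ?(factor_dvd Eps).
have aff_A : affine A by apply: affine_coset; apply: zmod_vset.
have aff_W : {in [seq vset (W P) | P <- free_ps], forall B, affine B}.
  by move=> _ /mapP[P _ ->]; apply: affine_zmod; apply: zmod_vset.
have [|x Tx np_x] := non_powers_meet_affine aff_A aff_W.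
  rewrite -/T (size_map (fun P => vset (W P)) free_ps) -/r card_ext.
  have [le_rm le_rq] : (r <= m)%N /\ (2 * r <= m + q)%N.
    split; first exact: leq_trans le_free le_psm.
    by apply: leq_trans le_psq; rewrite leq_mul.
  have q_gt0 : (0 < q)%N by rewrite ltnW // q_gt1.
  have Q_gt0 : (0 < q ^ (2 * (r + \sum_i d i)))%N by rewrite expn_gt0 q_gt0.
  rewrite -(ltn_pmul2r Q_gt0).
  have le_T : ((q - 1) ^ r * q ^ m <= #|T| * q ^ (r + \sum_i d i))%N.
    rewrite expnD mulnA [(#|T| * _)%N]mulnC.
    apply: leq_trans (leq_mul card_T (leqnn _)).
    by rewrite -mulnA cardA -expnD leq_mul // leq_pexp2l.
  apply: (@leq_trans ((totient (q ^ m).-1 * ((q - 1) ^ r * q ^ m)) ^ 2)).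
    rewrite -(expnM q m) [(m * 3)%N]mulnC mulnA -(expnD 4).
    exact: bound.
  rewrite [(2 * _)%N]mulnC expnM -expnMn leq_exp2r // -mulnA.
  by rewrite leq_mul.
have Tr_x i : Tr m (d i) (x : L) = a i.
  move: Tx; rewrite !inE => /andP[_ /V0P/(_ i)].
  by rewrite linearB /= -!Tr_act Tr_x0 => /eqP; rewrite subr_eq0 => /eqP.
exists (x : L); split=> //.
  have nz_x : (x : E) != 0 by move: np_x; rewrite in_non_powers => /andP[].
  by exists (finField_unit nz_x) => //; rewrite -generator_non_powers.
apply: (@normal_of_factors F L ps ps_irr Eps x) => P P_ps.
(* If [P] divides [X^(d i) - 1], then [(X^m - 1) / P] factors through the trace
   onto the [i]-th subfield, and [x] has there the normal trace [a i]. *)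
have [/existsP[i P_di]|P_free] := boolP (fixed P); last first.
  have {}P_free : P \in free_ps by rewrite mem_filter P_free.
  move: Tx; rewrite in_setD in_bigcup_seq has_map.
  by move=> /andP[/hasPn/(_ P P_free)]; rewrite /= inE WP.
rewrite -(trpolyP F (d_m i)) -divp_mulA // [_ * (_ %/ _)]mulrC actM.
have -> : act (trpoly F m (d i)) (x : L) = a i by rewrite -Tr_act; apply: Tr_x.
have nz_Xd : 'X^(d i) - 1 != 0 :> {poly F}.
  by rewrite -size_poly_gt0 size_XnsubC // -dimK adim_gt0.
apply: (act_normal (a_norm i)); first by rewrite dvdp_div_eq0.
have := monic_irreducible_size (factor_irr ps_irr P_ps).
rewrite size_divp; last by apply: contraTneq P_di => ->; rewrite dvd0p.
rewrite size_XnsubC -?dimK ?adim_gt0 //.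
by move: (\dim (K i)) (size P) => n [|[|b]] //= _; rewrite subSS leq_subr.
Qed.

End Criterion.

(** * Prime factors and the totient *)

Section Numerics.

Local Open Scope nat_scope.

(* For a prime [p] the fifth power of [2 p / (p - 1)] is at most [4 ^ 5 * p], and
   even at most [p] once [p >= 37]. *)
Let weight (p : nat) := if p < 37 then 4 ^ 5 else 1.

Let ratio_power_bound a b c p : 0 < a -> a * (2 * p) <= b * p.-1 ->
  c <= p -> b ^ 5 <= a ^ 5 * c -> (2 * p) ^ 5 <= p.-1 ^ 5 * p.
Proof.
move=> a_gt0 le_base le_cp le_ba.
have a5_gt0 : 0 < a ^ 5 by rewrite expn_gt0 a_gt0.
rewrite -(leq_pmul2l a5_gt0) -expnMn.
apply: (@leq_trans ((b * p.-1) ^ 5)); first by rewrite leq_exp2r.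
rewrite expnMn mulnCA mulnC leq_mul // (leq_trans le_ba) //.
by rewrite leq_mul.
Qed.

Lemma weightP p : prime p -> (2 * p) ^ 5 <= weight p * (p.-1 ^ 5 * p).
Proof.
move=> p_pr; have p_gt1 := prime_gt1 p_pr; rewrite /weight.
case: ifPn => [_ | p_ge37].
  apply: (@leq_trans ((4 * p.-1) ^ 5)); first by rewrite leq_exp2r //; lia.
  by rewrite expnMn mulnA leq_pmulr // prime_gt0.
rewrite -leqNgt in p_ge37; rewrite mul1n.
apply: (@ratio_power_bound 36 74 37 p); [by [] | by lia | by [] |].
by rewrite !expnS expn0; lia.
Qed.

(** Multiplying the bounds [weightP] over the primes dividing [n]. There are 11
    primes below 37, whence the constant [(4 ^ 5) ^ 11 = 2 ^ 110]. The exponent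
    1/5 is a compromise: it leaves room in all the cases at hand, while a smaller
    one would require a larger constant. *)
Lemma totient_primes_bound n : 0 < n ->
  2 ^ (5 * size (primes n)) * n ^ 4 <= 2 ^ 110 * totient n ^ 5.
Proof.
move=> n_gt0; rewrite totientE //.
have En : n = \prod_(p <- primes n) p ^ logn p n.
  by rewrite {1}(prod_prime_decomp n_gt0) prime_decompE big_map.
have expP k f : (\prod_(p <- primes n) f p) ^ k = \prod_(p <- primes n) f p ^ k.
  exact: (big_morph (fun x => x ^ k) (fun a b => expnMn a b k) (exp1n k)).
have constP c : \prod_(p <- primes n) c = c ^ size (primes n).
  by rewrite big_const_seq count_predT iter_muln_1.
have le_weight : \prod_(p <- primes n) weight p <= 2 ^ 110.
  have -> : 110 = 10 * 11 by [].
  rewrite expnM (_ : 2 ^ 10 = 4 ^ 5) // /weight -big_mkcond /=.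
  rewrite -big_filter big_const_seq count_predT iter_muln_1 leq_exp2l //.
  rewrite -[11]/(size [seq p <- iota 0 37 | prime p]) uniq_leq_size //.
    by rewrite filter_uniq // primes_uniq.
  move=> p; rewrite !mem_filter mem_iota mem_primes /= => /andP[lt_p /and3P[p_pr _ _]].
  by rewrite p_pr.
apply: leq_trans (leq_mul le_weight (leqnn _)).
rewrite expnM -constP [X in X ^ 4]En !expP -!big_split /= big_seq [leqRHS]big_seq.
apply: leq_prod => p /[dup] p_n /[!mem_primes]/and3P[p_pr _ _].
have e_gt0 : 0 < logn p n by rewrite logn_gt0.
case: (logn p n) e_gt0 => // e _ /=.
have p_gt0 := prime_gt0 p_pr.
have p5_gt0 : 0 < p ^ 5 by rewrite expn_gt0 p_gt0.
rewrite -(leq_pmul2r p5_gt0).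
have -> : 2 ^ 5 * (p ^ e.+1) ^ 4 * p ^ 5 = (2 * p) ^ 5 * p ^ (4 * e.+1).
  by rewrite expnMn -expnM [e.+1 * 4]mulnC; lia.
apply: leq_trans (leq_mul (weightP p_pr) (leqnn _)) _.
rewrite -mulnA -[leqRHS]mulnA leq_mul2l; apply/orP; right.
rewrite expnMn -mulnA -[leqRHS]mulnA leq_mul2l; apply/orP; right.
rewrite -expnM -expnS -expnD.
by rewrite leq_pexp2l //; lia.
Qed.

End Numerics.

(** * Comparing powers of [2] and [q] *)

Section ExponentCriterion.

Local Open Scope nat_scope.

Let cancel_powers (W Q C Phi P D R S : nat) : 0 < W -> 0 < R -> 0 < Q ->
  W * Q ^ 24 <= C * Phi -> P <= D * R -> C * D * S < Q ^ 9 ->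
  W * P * Q ^ 45 * S < Phi * R * Q ^ 30.
Proof.
move=> W_gt0 R_gt0 Q_gt0 hB hA hC.
have C_gt0 : 0 < C.
  rewrite lt0n; apply: contraTneq hB => ->.
  by rewrite mul0n -ltnNge muln_gt0 W_gt0 expn_gt0 Q_gt0.
rewrite -(ltn_pmul2l C_gt0).
apply: (@leq_ltn_trans (C * D * S * (W * R * Q ^ 45))).
  apply: (@leq_trans (C * (W * (D * R) * Q ^ 45 * S))).
    by rewrite leq_mul // !leq_mul2r leq_mul2l hA !orbT.
  by apply: eq_leq; ring.
apply: (@leq_trans (Q ^ 9 * (W * R * Q ^ 45))).
  have WRQ_gt0 : 0 < W * R * Q ^ 45.
    by rewrite muln_gt0 [0 < W * R]muln_gt0 W_gt0 R_gt0 expn_gt0 Q_gt0.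
  by rewrite (ltn_pmul2r WRQ_gt0).
apply: (@leq_trans (W * Q ^ 24 * (R * Q ^ 30))); first by apply: eq_leq; ring.
by rewrite -(mulnA Phi) [leqRHS]mulnA leq_mul2r hB orbT.
Qed.

Let base_ratio q : 5 <= q -> (2 * q) ^ 3 <= 2 ^ 4 * (q - 1) ^ 3.
Proof. by move=> /subnK <-; move: (q - 5) => p; rewrite !expnS !expn0; nia. Qed.

(** Both sides are raised to the power 15: a factor 5 is due to the fifth powers
    in [totient_primes_bound], and a factor 3 to the estimate
    [2 q / (q - 1) <= 2 ^ (4 / 3)], valid for [q >= 5]. The constant 684 is
    [6 * 110 + 24], the last term coming from [Q <= 2 n]. *)
Lemma counting_bound (q m s r : nat) : 5 <= q -> 0 < m ->
    2 ^ (684 + 40 * r) * q ^ (30 * s) < q ^ (9 * m) ->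
  4 ^ (size (primes (q ^ m).-1) + r) * q ^ (3 * m) * q ^ (2 * (r + s))
    < (totient (q ^ m).-1 * ((q - 1) ^ r * q ^ m)) ^ 2.
Proof.
move=> q_ge5 m_gt0 bound; have q_gt0 : 0 < q by apply: leq_trans q_ge5.
set Q := q ^ m; set n := Q.-1; set w := size (primes n).
have Q_gt1 : 1 < Q by rewrite -(expn0 q) ltn_exp2l // (leq_trans _ q_ge5).
have n_gt0 : 0 < n by rewrite /n -subn1 subn_gt0.
have Q_n : Q <= 2 * n by rewrite /n; move: (Q) Q_gt1 => x; lia.
rewrite -(@ltn_exp2r _ _ 15) //.
have hB : 2 ^ (30 * w) * Q ^ 24 <= 2 ^ 684 * totient n ^ 30.
  apply: (@leq_trans (2 ^ (30 * w) * (2 * n) ^ 24)).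
    by rewrite leq_mul2l leq_exp2r // Q_n orbT.
  have := totient_primes_bound n_gt0; rewrite -/w => tb.
  have -> : 2 ^ 684 = 2 ^ 24 * (2 ^ 110) ^ 6 by rewrite -expnM -expnD; congr (2 ^ _).
  have -> : 2 ^ (30 * w) = (2 ^ (5 * w)) ^ 6 by rewrite -expnM; congr (2 ^ _); lia.
  rewrite [(2 * n) ^ 24]expnMn.
  have -> : n ^ 24 = (n ^ 4) ^ 6 by rewrite -expnM.
  have -> : totient n ^ 30 = (totient n ^ 5) ^ 6 by rewrite -expnM.
  move: (2 ^ 24) (2 ^ 110) (2 ^ (5 * w)) (n ^ 4) (totient n ^ 5) tb => B A x y z tb.
  have -> : x ^ 6 * (B * y ^ 6) = B * (x * y) ^ 6 by rewrite expnMn mulnCA.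
  have -> : B * A ^ 6 * z ^ 6 = B * (A * z) ^ 6 by rewrite expnMn mulnA.
  by rewrite leq_mul2l leq_exp2r // tb orbT.
have hA : (2 * q) ^ (30 * r) <= 2 ^ (40 * r) * (q - 1) ^ (30 * r).
  have h1 := base_ratio q_ge5.
  rewrite (_ : 30 * r = 3 * (10 * r)); last by lia.
  rewrite (_ : 40 * r = 4 * (10 * r)); last by lia.
  rewrite !(expnM _ 3) (expnM 2 4) -expnMn.
  by case: r {bound} => // r; rewrite leq_exp2r.
have hC : 2 ^ 684 * 2 ^ (40 * r) * q ^ (30 * s) < Q ^ 9.
  by rewrite -expnD /Q -expnM [m * 9]mulnC.
have q1_gt0 : 0 < q - 1 by rewrite subn_gt0; apply: leq_trans q_ge5.
have W_gt0 : 0 < 2 ^ (30 * w) by rewrite expn_gt0.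
have R_gt0 : 0 < (q - 1) ^ (30 * r) by rewrite expn_gt0 q1_gt0.
have := cancel_powers W_gt0 R_gt0 (ltnW Q_gt1) hB hA hC; clear hB hA hC bound.
set lhs := (X in X < _); set rhs := (X in _ < X) => lt_lr.
have -> : (4 ^ (w + r) * q ^ (3 * m) * q ^ (2 * (r + s))) ^ 15 = lhs.
  rewrite /lhs (expnMn 2 q) (_ : 4 = 2 ^ 2) // -!expnM !expnMn -!expnM.
  rewrite (_ : 2 * (w + r) * 15 = 30 * w + 30 * r); last by lia.
  rewrite (_ : 3 * m * 15 = m * 45); last by lia.
  rewrite (_ : 2 * (r + s) * 15 = 30 * r + 30 * s); last by lia.
  by rewrite !expnD; ring.
have -> : ((totient n * ((q - 1) ^ r * Q)) ^ 2) ^ 15 = rhs.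
  rewrite /rhs -expnM !expnMn -expnM (_ : 2 * 15 = 30) //.
  by rewrite [30 * r]mulnC mulnA.
exact: lt_lr.
Qed.

(** Comparing exponents through a lower bound [2 ^ (a / b)] for [q]. *)
Lemma exponent_bound (a b q m s r : nat) : 0 < b -> 2 ^ a <= q ^ b ->
    30 * s <= 9 * m -> b * (684 + 40 * r) < a * (9 * m - 30 * s) ->
  2 ^ (684 + 40 * r) * q ^ (30 * s) < q ^ (9 * m).
Proof.
move=> b_gt0 le_ab le_sm lt_ab.
have q_gt0 : 0 < q.
  by case: q le_ab => //; rewrite exp0n // leqNgt expn_gt0.
have qs_gt0 : 0 < q ^ (30 * s) by rewrite expn_gt0 q_gt0.
rewrite -(subnK le_sm) (expnD q) (ltn_pmul2r qs_gt0).
rewrite -(ltn_exp2r _ _ b_gt0) -!expnM [_ * b]mulnC.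
apply: (@leq_trans (2 ^ (a * (9 * m - 30 * s)))); first by rewrite ltn_exp2l.
move: (9 * m - 30 * s) => e; rewrite (expnM 2) (mulnC e) (expnM q).
by case: e => // e; rewrite leq_exp2r.
Qed.

End ExponentCriterion.

(** * Sums and products of the degrees *)

Section DegreeBounds.

Local Open Scope nat_scope.

(** The ratio of the sum to the product decreases in each variable: in the term
    [d i], replace all the other [d j] in the product by [e j]. *)
Lemma sum_prod_bound k (e d : 'I_k -> nat) : (forall i, e i <= d i) ->
  (\prod_i e i) * (\sum_i d i) <= (\sum_i e i) * \prod_i d i.
Proof.
move=> le_ed; rewrite big_distrr big_distrl leq_sum //= => i _.
rewrite (bigD1 i) //= [X in _ <= _ * X](bigD1 i) //= -mulnA leq_mul2l.
by rewrite mulnC leq_mul2l leq_prod ?orbT // => j _; apply: le_ed.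
Qed.

Lemma prod_coprime_dvd (I : eqType) (s : seq I) (d : I -> nat) m :
    uniq s -> (forall i j, i != j -> coprime (d i) (d j)) ->
    (forall i, d i %| m) -> \prod_(i <- s) d i %| m.
Proof.
move=> s_uniq co_d d_m; elim: s s_uniq => [|i s IH]; first by rewrite big_nil dvd1n.
case/andP=> i_s s_uniq; rewrite big_cons Gauss_dvd ?d_m ?IH //.
rewrite big_seq; apply: (big_rec (coprime (d i))) => [|j x js co_x].
  exact: coprimen1.
rewrite coprimeMr co_x andbT co_d //.
by apply: contraNneq i_s => ->.
Qed.

End DegreeBounds.

(** * The cases *)

Section Assembly.

Local Open Scope nat_scope.

Lemma lambda_lower_bound m k (d : k.-tuple nat) : 1 < k -> lambda m d ->
  forall i : 'I_k, i.+2 <= tnth d i.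
Proof.
move=> k_gt1 [d_dvd d_lt] [i lt_ik] /=.
elim: i lt_ik => [|i IH] lt_ik.
  have /andP[d_gt0 _] := d_dvd (Ordinal lt_ik).
  have /andP[_ ndiv] := d_lt (Ordinal lt_ik) (Ordinal k_gt1) isT.
  case: (tnth d (Ordinal lt_ik)) d_gt0 ndiv => [|[]] //.
  by rewrite dvd1n.
have lt_ik' := ltnW lt_ik.
have /andP[lt_d _] := d_lt (Ordinal lt_ik') (Ordinal lt_ik) (leqnn _).
exact: leq_ltn_trans (IH lt_ik') lt_d.
Qed.

Lemma coprime_of_pairwise k (d : k.-tuple nat) : pairwise_coprime d ->
  forall i j : 'I_k, i != j -> coprime (tnth d i) (tnth d j).
Proof.
move=> co_d i j; rewrite -(inj_eq val_inj) neq_ltn => /orP[/co_d //|/co_d].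
by rewrite coprime_sym.
Qed.

Lemma lambda_prod_le m k (d : k.-tuple nat) : 0 < m -> lambda m d ->
  pairwise_coprime d -> \prod_i tnth d i <= m.
Proof.
move=> m_gt0 [d_dvd _] co_d; apply: dvdn_leq => //.
apply: prod_coprime_dvd; first exact: index_enum_uniq.
  exact: coprime_of_pairwise.
by move=> i; case/and3P: (d_dvd i).
Qed.

Lemma traces_prescribable_of_bound (F : finFieldType) (L : fieldExtType F)
    (k : nat) (d : k.-tuple nat) :
    let q := #|F| in let m := \dim {:L} in
    coprime m q -> lambda m d -> pairwise_coprime d -> 5 <= q ->
    (forall r, r <= m -> 2 * r <= m + q ->
       2 ^ (684 + 40 * r) * q ^ (30 * (\sum_i tnth d i)) < q ^ (9 * m)) ->
  traces_prescribable L d.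
Proof.
move=> q m co_mq [d_dvd _] co_d q_ge5 bound K a dimK Ka adm a_norm.
have co_dn := coprime_of_pairwise co_d.
apply: (@prescribed_traces_criterion F L k (tnth d) K (tnth a)) => //.
- by move=> i; case/and3P: (d_dvd i).
- have lt_Tr (i j : 'I_k) : i < j -> Tr (tnth d i) 1 (tnth a i) = Tr (tnth d j) 1 (tnth a j).
    by move=> lt_ij; have /= := adm i j lt_ij; rewrite (eqP (co_d i j lt_ij)).
  move=> i j; case: (ltngtP i j) => [/lt_Tr //|/lt_Tr //|/val_inj -> //].
by move=> r le_rm le_rq; apply: counting_bound => //; [apply: adim_gt0 | apply: bound].
Qed.

(** In this and the next five lemmas, [exponent_bound] is applied with a rational
    lower approximation [a / b] of the base 2 logarithm of the least [q]. Where
    only small [q] have to be considered, the bound [2 r <= m + q] replaces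
    [r <= m]. *)
Lemma exponents_huge_q q m s r : 2 ^ 100 <= q -> 18 <= m -> 15 * s <= 4 * m -> r <= m ->
  2 ^ (684 + 40 * r) * q ^ (30 * s) < q ^ (9 * m).
Proof.
move=> q_ge m_ge le_sm le_rm.
apply: (@exponent_bound 100 1); [by [] | exact: q_ge | |];
  by clear q_ge; lia.
Qed.

Lemma exponents_four_traces q m s r : 1334 <= q -> 120 * s <= 14 * m -> 120 <= m -> r <= m ->
  2 ^ (684 + 40 * r) * q ^ (30 * s) < q ^ (9 * m).
Proof.
move=> q_ge le_sm m_ge le_rm.
apply: (@exponent_bound 10 1); [by [] | | by lia | by lia].
by apply: leq_trans q_ge.
Qed.

Lemma exponents_many_traces q m s r : 64 <= q -> 36 * s <= m -> 720 <= m -> r <= m ->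
  2 ^ (684 + 40 * r) * q ^ (30 * s) < q ^ (9 * m).
Proof.
move=> q_ge le_sm m_ge le_rm.
apply: (@exponent_bound 6 1); [by [] | exact: q_ge | by lia | by lia].
Qed.

Lemma exponents_five_traces q m s r : 9 <= q < 64 -> 36 * s <= m -> 720 <= m ->
    2 * r <= m + q ->
  2 ^ (684 + 40 * r) * q ^ (30 * s) < q ^ (9 * m).
Proof.
move=> /andP[q_ge q_lt] le_sm m_ge le_rm.
apply: (@exponent_bound 3 1); [by [] | | by lia | by lia].
by apply: leq_trans q_ge.
Qed.

Lemma exponents_six_traces q m s r : 7 <= q < 64 -> 560 * s <= 3 * m -> 720 <= m ->
    2 * r <= m + q ->
  2 ^ (684 + 40 * r) * q ^ (30 * s) < q ^ (9 * m).
Proof.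
move=> /andP[q_ge q_lt] le_sm m_ge le_rm.
apply: (@exponent_bound 14 5); [by [] | | by lia | by lia].
by apply: (@leq_trans (7 ^ 5)); [vm_compute | rewrite leq_exp2r].
Qed.

Lemma exponents_seven_traces q m s r : 5 <= q < 64 -> 1152 * s <= m -> 4000 <= m ->
    2 * r <= m + q ->
  2 ^ (684 + 40 * r) * q ^ (30 * s) < q ^ (9 * m).
Proof.
move=> /andP[q_ge q_lt] le_sm m_ge le_rm.
apply: (@exponent_bound 16 7); [by [] | | by lia | by lia].
by apply: (@leq_trans (5 ^ 7)); [vm_compute | rewrite leq_exp2r].
Qed.

(** The only triples for which the product alone does not suffice have
    [d0 = 2] and [d1 <= 4]; for them [m >= 60] takes over when [d2] is small. *)
Lemma three_degrees_sum m d0 d1 d2 : 2 <= d0 -> d0 < d1 -> d1 < d2 ->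
    d0 * (d1 * d2) <= m -> 60 <= m ->
  4 * (d0 + (d1 + d2)) <= m.
Proof.
move=> d0_ge lt01 lt12 le_m m_ge.
have [d0_3|d0_2] := leqP 3 d0.
  have : 3 * (4 * d2) <= d0 * (d1 * d2) by rewrite !leq_mul //; lia.
  by lia.
have {d0_ge d0_2} E0 : d0 = 2 by lia.
move: E0 lt01 le_m => -> lt01 le_m.
have [d1_5|d1_lt] := leqP 5 d1.
  have : 5 * d2 <= d1 * d2 by rewrite leq_mul.
  by lia.
have [E1|E1] : d1 = 3 \/ d1 = 4 by lia.
  by move: E1 lt12 le_m => -> *; lia.
by move: E1 lt12 le_m => -> *; lia.
Qed.

Lemma two_degrees_sum m d1 d2 : d1 < d2 -> d1 * d2 <= m ->
  [\/ 8 <= d1, d1 = 7 /\ d2 <> 8 | d1 = 6 /\ 13 <= d2] ->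
  15 * (d1 + d2) <= 4 * m /\ 18 <= m.
Proof.
move=> lt12 le_m [d1_ge|[E1 ne8]|[E1 d2_ge]].
- have : 8 * d2 <= d1 * d2 by rewrite leq_mul.
  by lia.
- by move: E1 lt12 le_m => -> lt12 le_m; split; lia.
by move: E1 lt12 le_m => -> lt12 le_m; split; lia.
Qed.

Lemma q_bound3_ge : 2 ^ 100 <= q_bound3.
Proof.
rewrite /q_bound3; set N := locked _.
have N_ge : 100 <= N.
  by rewrite /N -lock; apply: (@leq_trans 852); [by [] | apply: leq_addl].
apply: (@leq_trans (10 ^ 100)); first by rewrite leq_exp2r.
apply: (@leq_trans (10 ^ N)); first by rewrite leq_exp2l.
by rewrite leq_pmull.
Qed.

(** Strictly increasing degrees with [d_0 >= 2] are bounded below by 2, 3, 4 and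
    so on, and the ratio of their sum to their product is largest there. *)
Lemma lambda_sum_le m k (d : k.-tuple nat) : 1 < k -> 0 < m -> lambda m d ->
  pairwise_coprime d ->
  \prod_(i < k) i.+2 <= m /\
  (\prod_(i < k) i.+2) * (\sum_i tnth d i) <= (\sum_(i < k) i.+2) * m.
Proof.
move=> k_gt1 m_gt0 d_lam co_d; have d_ge := lambda_lower_bound k_gt1 d_lam.
have le_m := lambda_prod_le m_gt0 d_lam co_d.
split; first by apply: leq_trans le_m; apply: leq_prod => i _; apply: d_ge.
by apply: leq_trans (sum_prod_bound d_ge) _; rewrite leq_mul2l le_m orbT.
Qed.

End Assembly.

Theorem theorem5p1 :
  (forall (F : finFieldType) (L : fieldExtType F) (k : nat) (d : k.-tuple nat),
     let q := #|F| in let m := \dim {:L} in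
     coprime m q -> 1 < k < size (divisors m) ->
     lambda m d -> pairwise_coprime d ->
     [\/ [\/ k = 4 /\ 1334 <= q, k = 5 /\ 9 <= q, k = 6 /\ 7 <= q
           | k = 7 /\ 5 <= q]
       | [/\ k = 3, 60 <= m & q_bound3 <= q]] ->
     traces_prescribable L d)
  /\
  (forall d1 d2 : nat,
     [\/ 8 <= d1, d1 = 7 /\ (d1, d2) <> (7, 8) | d1 = 6 /\ 13 <= d2] ->
     exists Q : nat,
       forall (F : finFieldType) (L : fieldExtType F),
         let q := #|F| in let m := \dim {:L} in
         let d := [tuple d1; d2] in
         coprime m q -> 2 < size (divisors m) ->
         lambda m d -> pairwise_coprime d ->
         Q <= q ->
         traces_prescribable L d).
Proof.
split=> [F L k d q m co_mq /andP[k_gt1 _] d_lam co_d cases|d1 d2 cases].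
  have m_gt0 : 0 < m by apply: adim_gt0.
  have [m_ge le_s] := lambda_sum_le k_gt1 m_gt0 d_lam co_d.
  suff [q_ge5 bound] : 5 <= q /\ forall r, r <= m -> 2 * r <= m + q ->
       2 ^ (684 + 40 * r) * q ^ (30 * (\sum_i tnth d i)) < q ^ (9 * m).
    exact: traces_prescribable_of_bound co_mq d_lam co_d q_ge5 bound.
  case: cases => [cases|[Ek m_ge60 q_ge]]; last first.
    subst k; have d0_ge := lambda_lower_bound k_gt1 d_lam ord0.
    have prod_m := lambda_prod_le m_gt0 d_lam co_d; have [_ d_lt] := d_lam.
    have {}q_ge : 2 ^ 100 <= q by apply: leq_trans q_bound3_ge q_ge.
    split; first by apply: leq_trans q_ge; rewrite (@leq_trans (2 ^ 3)) // leq_exp2l.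
    move=> r le_rm _; apply: exponents_huge_q => //; first by apply: leq_trans m_ge60.
    have /andP[lt01 _] := d_lt ord0 (lift ord0 ord0) isT.
    have /andP[lt12 _] := d_lt (lift ord0 ord0) (lift ord0 (lift ord0 ord0)) isT.
    move: prod_m; rewrite !big_ord_recl !big_ord0 muln1 addn0 => prod_m.
    have le_s4 := three_degrees_sum d0_ge lt01 lt12 prod_m m_ge60.
    by clear q_ge; lia.
  move: le_s; move: (\sum_i tnth d i) => s.
  case: cases => -[Ek q_ge]; subst k; move: m_ge;
    rewrite !big_ord_recl !big_ord0 /= /bump /= => m_ge le_s.
  - split=> [|r le_rm _]; first by apply: leq_trans q_ge.
    by apply: exponents_four_traces => //; lia.
  - split=> [|r le_rm le_rq]; first by apply: leq_trans q_ge.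
    have [q_lt|q_ge64] := ltnP q 64; last by apply: exponents_many_traces => //; lia.
    by apply: exponents_five_traces; rewrite ?q_ge //; lia.
  - split=> [|r le_rm le_rq]; first by apply: leq_trans q_ge.
    have [q_lt|q_ge64] := ltnP q 64; last by apply: exponents_many_traces => //; lia.
    by apply: exponents_six_traces; rewrite ?q_ge //; lia.
  split=> // r le_rm le_rq.
  have [q_lt|q_ge64] := ltnP q 64; last by apply: exponents_many_traces => //; lia.
  by apply: exponents_seven_traces; rewrite ?q_ge //; lia.
exists (2 ^ 100) => F L q m d co_mq _ d_lam co_d q_ge.
have m_gt0 : 0 < m by apply: adim_gt0.
have prod_m := lambda_prod_le m_gt0 d_lam co_d; have [_ d_lt] := d_lam.
have /andP[lt12 _] := d_lt ord0 ord_max isT.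
have [le_s m_ge] : 15 * (d1 + d2) <= 4 * m /\ 18 <= m.
  apply: two_degrees_sum => //.
    by move: prod_m; rewrite !big_ord_recl big_ord0 muln1.
  case: cases => [|[-> ne]|]; [by constructor 1 | | by constructor 3].
  by constructor 2; split=> // E2; apply: ne; rewrite E2.
apply: (traces_prescribable_of_bound co_mq d_lam co_d).
  by apply: leq_trans q_ge; rewrite (@leq_trans (2 ^ 3)) // leq_exp2l.
move=> r le_rm _; apply: exponents_huge_q => //.
by rewrite !big_ord_recl big_ord0 addn0.
Qed.
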